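(* Let $r\ge1$ and let $G=\overline{\langle a_1,\dots,a_r\rangle}\subset W$ be the closed subgroup topologically generated by the elements $a_1,\dots,a_r\in W$ determined by $a_1=(a_r,1)\,\sigma$ and $a_i=(a_{i-1},1)$ for $2\le i\le r$. Let $N:=\operatorname{Norm}_W(G)$ be the normalizer of $G$ in $W$, and let $G_{\mathrm{ab}}$ be the maximal profinite abelian factor group of $G$, identified with $\mathbb{Z}_2^r$ via the basis given by the images of $a_1,\dots,a_r$. Then the natural homomorphism $N\to\operatorname{Aut}(G_{\mathrm{ab}})$ (induced by conjugation) induces an isomorphism $$N/G\ \xrightarrow{\ \sim\ }\ (\mathbb{Z}_2^\times)^r\ \subset\ \operatorname{Aut}(\mathbb{Z}_2^r)\cong\operatorname{Aut}(G_{\mathrm{ab}}),$$ where $(\mathbb{Z}_2^\times)^r$ acts on $\mathbb{Z}_2^r$ by coordinatewise multiplication.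
   Context: $T$ is the infinite rooted binary tree whose vertices are the finite words over $\{0,1\}$, with root the empty word, each word $t$ being joined by an edge to $t0$ and $t1$. $W:=\operatorname{Aut}(T)$ is its automorphism group, a profinite group as the inverse limit of the finite groups $W_n=\operatorname{Aut}(T_n)$, where $T_n\subset T$ is the subtree of words of length $\le n$. For $u,v\in W$, $(u,v)\in W$ denotes the automorphism $0t\mapsto 0\,u(t)$, $1t\mapsto 1\,v(t)$ for all words $t$; $\sigma\in W$ is the automorphism of order $2$ with $0t\mapsto 1t$ and $1t\mapsto 0t$. Thus $W=(W\times W)\rtimes\langle\sigma\rangle$. The recursion relations for $a_1,\dots,a_r$ have a unique solution in $W$. $\mathbb{Z}_2$ is the ring of $2$-adic integers. It is known that $G_{\mathrm{ab}}$ (the quotient of $G$ by the closure of its commutator subgroup) is a free $\mathbb{Z}_2$-module of rank $r$ with basis the images of $a_1,\dots,a_r$. *)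

(* Defs.v *)
From HB Require Import structures.
From mathcomp Require Import all_boot all_algebra generic_quotient.
From mathcomp Require Import boolp classical_sets functions topology.

Set Implicit Arguments.
Unset Strict Implicit.
Unset Printing Implicit Defensive.

Import GRing.Theory.
Local Open Scope classical_set_scope.
Local Open Scope group_scope.

#[short(type="preTopGroupType")]
HB.structure Definition PreTopologicalGroup := {G of Topological G & Group G}.

HB.mixin Record PreTopologicalGroup_isTopologicalGroup G
    of PreTopologicalGroup G := {
  mulg_continuous : continuous (fun xy : G * G => xy.1 * xy.2);
  invg_continuous : continuous (fun x : G => x^-1)
}.

#[short(type="topGroupType")]
HB.structure Definition TopologicalGroup :=
  {G of PreTopologicalGroup G & PreTopologicalGroup_isTopologicalGroup G}.

Definition homeomorphism (X Y : topologicalType) (f : X -> Y) : Prop :=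
  continuous f /\ exists g : Y -> X, [/\ continuous g, cancel f g & cancel g f].

Definition topgroup_iso (X Y : preTopGroupType) (f : X -> Y) : Prop :=
  {morph f : x y / x * y} /\ homeomorphism f.

(** Conjugation as a left action; the library's [x ^ y] is a right action. *)
Definition lconj (X : groupType) (x y : X) : X := x * y * x^-1.

Section LConj.
Variable X : groupType.
Implicit Types x y z : X.

Lemma lconj1 y : lconj 1 y = y.
Proof. by rewrite /lconj mul1g invg1 mulg1. Qed.

Lemma lconjM x y z : lconj (x * y) z = lconj x (lconj y z).
Proof. by rewrite /lconj invgM !mulgA. Qed.

Lemma lconjK x : cancel (lconj x) (lconj x^-1).
Proof. by move=> y; rewrite -lconjM mulVg lconj1. Qed.

Lemma lconjKV x : cancel (lconj x^-1) (lconj x).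
Proof. by move=> y; rewrite -lconjM mulgV lconj1. Qed.

Lemma lconj_mul x y z : lconj x (y * z) = lconj x y * lconj x z.
Proof. by rewrite /lconj !mulgA mulgVK. Qed.

Lemma lconj_inv x y : lconj x y^-1 = (lconj x y)^-1.
Proof. by rewrite /lconj !invgM invgK mulgA. Qed.

Lemma lconj_one x : lconj x 1 = 1.
Proof. by rewrite /lconj mulg1 mulgV. Qed.

End LConj.

Record subgroup (X : groupType) := Subgroup {
  carrier :> set X;
  sub1g : carrier 1;
  submg : forall x y, carrier x -> carrier y -> carrier (x * y);
  subvg : forall x, carrier x -> carrier x^-1
}.

Definition subgroup_type (X : groupType) (H : subgroup X) : Type :=
  set_type (carrier H).
Notation "[ 'grp' H ]" := (subgroup_type H) (format "[ 'grp'  H ]").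

Section SubgroupType.
Variables (X : groupType) (H : subgroup X).

HB.instance Definition _ := Choice.copy [grp H] (set_type (carrier H)).

Definition subgroup_val (x : [grp H]) : X := \val (x : set_type (carrier H)).
Definition subgroup_in (x : X) (Hx : carrier H x) : [grp H] :=
  exist _ x (mem_set Hx) : set_type (carrier H).

Lemma subgroup_valP x : carrier H (subgroup_val x).
Proof. exact: set_mem (valP (x : set_type (carrier H))). Qed.

Lemma subgroup_val_inj : injective subgroup_val.
Proof. exact: val_inj. Qed.

Let one := subgroup_in (sub1g H).
Let mul (x y : [grp H]) :=
  subgroup_in (submg (subgroup_valP x) (subgroup_valP y)).
Let inv (x : [grp H]) := subgroup_in (subvg (subgroup_valP x)).

Let mulA : associative mul.
Proof. by move=> x y z; apply: subgroup_val_inj; apply: mulgA. Qed.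
Let mul1 : left_id one mul.
Proof. by move=> x; apply: subgroup_val_inj; apply: mul1g. Qed.
Let mulx1 : right_id one mul.
Proof. by move=> x; apply: subgroup_val_inj; apply: mulg1. Qed.
Let mulV : left_inverse one inv mul.
Proof. by move=> x; apply: subgroup_val_inj; apply: mulVg. Qed.
Let mulxV : right_inverse one inv mul.
Proof. by move=> x; apply: subgroup_val_inj; apply: mulgV. Qed.

HB.instance Definition _ :=
  isGroup.Build [grp H] mulA mul1 mulx1 mulV mulxV.

Lemma subgroup_valM x y :
  subgroup_val (x * y) = subgroup_val x * subgroup_val y.
Proof. by []. Qed.
Lemma subgroup_valV x : subgroup_val x^-1 = (subgroup_val x)^-1.
Proof. by []. Qed.

End SubgroupType.

HB.instance Definition _ (X : preTopGroupType) (H : subgroup X) :=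
  Topological.copy [grp H] (set_type (carrier H)).

Section SubgroupTop.
Variables (X : topGroupType) (H : subgroup X).

Lemma subgroup_val_continuous : continuous (@subgroup_val X H).
Proof. exact: (@initial_continuous (set_type (carrier H)) X set_val). Qed.

Lemma continuous_subgroup (Y : topologicalType) (f : Y -> [grp H]) :
  continuous (@subgroup_val X H \o f) -> continuous f.
Proof.
exact: (@continuous_comp_initial (set_type (carrier H)) Y X set_val).
Qed.

Let mul_cont : continuous (fun xy : [grp H] * [grp H] => xy.1 * xy.2).
Proof.
apply: continuous_subgroup => -[x y].
apply: (@continuous_comp _ _ _
  (fun xy : [grp H] * [grp H] => (subgroup_val xy.1, subgroup_val xy.2))
  (fun xy : X * X => xy.1 * xy.2)); last exact: mulg_continuous.
apply: cvg_pair.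
  apply: (@continuous_comp _ _ _ fst); first exact: cvg_fst.
  exact: subgroup_val_continuous.
apply: (@continuous_comp _ _ _ snd); first exact: cvg_snd.
exact: subgroup_val_continuous.
Qed.

Let inv_cont : continuous (fun x : [grp H] => x^-1).
Proof.
apply: continuous_subgroup => x.
apply: (@continuous_comp _ _ _ (@subgroup_val X H) (fun x : X => x^-1)).
  exact: subgroup_val_continuous.
exact: invg_continuous.
Qed.

HB.instance Definition _ :=
  PreTopologicalGroup_isTopologicalGroup.Build [grp H] mul_cont inv_cont.

End SubgroupTop.

Section GeneratedSubgroup.
Variables (X : groupType) (A : set X).

Definition gen_set : set X :=
  [set x | forall H : subgroup X, A `<=` H -> carrier H x].

Lemma gen_set1 : gen_set 1.
Proof. by move=> H _; exact: sub1g. Qed.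
Lemma gen_setM x y : gen_set x -> gen_set y -> gen_set (x * y).
Proof. by move=> Ax Ay H AH; apply: submg; [exact: Ax|exact: Ay]. Qed.
Lemma gen_setV x : gen_set x -> gen_set x^-1.
Proof. by move=> Ax H AH; apply: subvg; exact: Ax. Qed.

Definition gen : subgroup X := Subgroup gen_set1 gen_setM gen_setV.

End GeneratedSubgroup.

Section ClosureSubgroup.
Variables (X : topGroupType) (H : subgroup X).

Lemma closure1 : closure H (1 : X).
Proof. by apply: subset_closure; exact: sub1g. Qed.

Lemma closureM (x y : X) :
  closure H x -> closure H y -> closure H (x * y).
Proof.
move=> Hx Hy B /(@mulg_continuous X (x, y)) [[U V] /= [Ux Vy] UVB].
have [u [Hu Uu]] := Hx _ Ux; have [v [Hv Vv]] := Hy _ Vy.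
by exists (u * v); split; [exact: submg|exact: (UVB (u, v))].
Qed.

Lemma closureV (x : X) : closure H x -> closure H x^-1.
Proof.
move=> Hx B /(@invg_continuous X x) Bx.
by have [u [Hu Uu]] := Hx _ Bx; exists u^-1; split => //; exact: subvg.
Qed.

Definition closure_subgroup : subgroup X := Subgroup closure1 closureM closureV.

End ClosureSubgroup.

Section Normalizer.
Variables (X : groupType) (H : subgroup X).

Definition normalizer_set : set X := [set x | lconj x @` H = H].

Lemma normalizer_set1 : normalizer_set 1.
Proof.
by rewrite /normalizer_set /= (_ : lconj 1 = id) ?image_id//;
  apply/funext => y; rewrite lconj1.
Qed.

Lemma normalizer_setM x y :
  normalizer_set x -> normalizer_set y -> normalizer_set (x * y).
Proof.
rewrite /normalizer_set /= => Nx Ny; rewrite -[RHS]Nx -[in RHS]Ny.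
by rewrite image_comp; congr (_ @` _); apply/funext => z; exact: lconjM.
Qed.

Lemma normalizer_setV x : normalizer_set x -> normalizer_set x^-1.
Proof.
rewrite /normalizer_set /= => Nx; rewrite -{1}Nx image_comp.
rewrite (_ : _ \o _ = id) ?image_id//.
by apply/funext => z; exact: lconjK.
Qed.

Definition normalizer : subgroup X :=
  Subgroup normalizer_set1 normalizer_setM normalizer_setV.

End Normalizer.

Record normal_subgroup (X : groupType) := NormalSubgroup {
  normal_sub :> subgroup X;
  normalP : forall x y, carrier normal_sub y -> carrier normal_sub (lconj x y)
}.

Section Quotient.
Local Open Scope quotient_scope.
Variables (X : groupType) (K : normal_subgroup X).

Definition coset_rel (x y : X) : bool := `[< carrier K (x^-1 * y) >].

Lemma coset_rel_refl : reflexive coset_rel.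
Proof. by move=> x; apply/asboolP; rewrite mulVg; exact: sub1g. Qed.
Lemma coset_rel_sym : symmetric coset_rel.
Proof.
by move=> x y; apply: asbool_equiv_eq; split => /(@subvg X K);
  rewrite invgM invgK.
Qed.
Lemma coset_rel_trans : transitive coset_rel.
Proof.
move=> y x z /asboolP xy /asboolP yz; apply/asboolP.
by have := submg xy yz; rewrite mulgA mulgK.
Qed.

Canonical coset_equiv :=
  EquivRel coset_rel coset_rel_refl coset_rel_sym coset_rel_trans.

Definition coset_quot := {eq_quot coset_equiv}.

End Quotient.

Definition quotient (X : preTopGroupType) (K : normal_subgroup X) : Type :=
  quotient_topology (coset_quot K).

Section QuotientGroup.
Local Open Scope quotient_scope.
Variables (X : preTopGroupType) (K : normal_subgroup X).

HB.instance Definition _ :=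
  Topological.copy (quotient K) (quotient_topology (coset_quot K)).

Definition qproj (x : X) : quotient K := \pi_(coset_quot K) x.
Definition qrepr (q : quotient K) : X := repr (q : coset_quot K).

Lemma qreprK : cancel qrepr qproj.
Proof. exact: reprK. Qed.

Lemma qprojP x y : qproj x = qproj y <-> carrier K (x^-1 * y).
Proof.
split=> [/eqquotP /asboolP //|Kxy].
by apply/eqquotP; apply/asboolP.
Qed.

Lemma qproj_repr x : carrier K (x^-1 * qrepr (qproj x)).
Proof. by apply/qprojP; rewrite qreprK. Qed.

Lemma qprojM_subproof x y x' y' : qproj x = qproj x' -> qproj y = qproj y' ->
  qproj (x * y) = qproj (x' * y').
Proof.
move=> /qprojP Kx /qprojP Ky; apply/qprojP.
rewrite (_ : _ * _ = lconj y^-1 (x^-1 * x') * (y^-1 * y')).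
  by apply: submg => //; exact: normalP.
by rewrite /lconj invgM invgK !mulgA mulgK.
Qed.

Lemma qprojV_subproof x x' : qproj x = qproj x' -> qproj x^-1 = qproj x'^-1.
Proof.
move=> /qprojP Kx; apply/qprojP.
rewrite (_ : _ * _ = lconj x (x^-1 * x')^-1); first exact/normalP/subvg.
by rewrite /lconj !invgM !invgK !mulgA mulgK.
Qed.

Let one := qproj 1.
Let mul p q := qproj (qrepr p * qrepr q).
Let inv q := qproj (qrepr q)^-1.

Let mulE x y : mul (qproj x) (qproj y) = qproj (x * y).
Proof. by apply: qprojM_subproof; rewrite qreprK. Qed.
Let invE x : inv (qproj x) = qproj x^-1.
Proof. by apply: qprojV_subproof; rewrite qreprK. Qed.

Let mulA : associative mul.
Proof.
by move=> p q s; rewrite -[p]qreprK -[q]qreprK -[s]qreprK !mulE mulgA.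
Qed.
Let mul1 : left_id one mul.
Proof. by move=> p; rewrite -[p]qreprK mulE mul1g. Qed.
Let mulx1 : right_id one mul.
Proof. by move=> p; rewrite -[p]qreprK mulE mulg1. Qed.
Let mulV : left_inverse one inv mul.
Proof. by move=> p; rewrite -[p]qreprK invE mulE mulVg. Qed.
Let mulxV : right_inverse one inv mul.
Proof. by move=> p; rewrite -[p]qreprK invE mulE mulgV. Qed.

HB.instance Definition _ :=
  isGroup.Build (quotient K) mulA mul1 mulx1 mulV mulxV.

Lemma qprojM x y : qproj (x * y) = qproj x * qproj y.
Proof. exact: (esym (mulE x y)). Qed.

Lemma qproj_continuous : continuous qproj.
Proof. exact: (@pi_continuous X (coset_quot K)). Qed.

Lemma quotient_cont (Z : topologicalType) (f : quotient K -> Z) :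
  continuous (f \o qproj) -> continuous f.
Proof. by move=> cf; apply/(@quotient_continuous X (coset_quot K) Z f). Qed.

End QuotientGroup.
Arguments qproj {X} K x.

Record topaut (X : preTopGroupType) := TopAut {
  topaut_fun :> X -> X;
  topautP : topgroup_iso topaut_fun
}.

Section TopAutGroup.
Variable X : preTopGroupType.
Implicit Types f g h : topaut X.

HB.instance Definition _ := gen_eqMixin (topaut X).
HB.instance Definition _ := gen_choiceMixin (topaut X).

Lemma topaut_ext f g : (f : X -> X) =1 g -> f = g.
Proof.
case: f g => [f Pf] [g Pg] /= /funext fg; rewrite fg in Pf *.
by congr TopAut; exact: Prop_irrelevance.
Qed.

Lemma topgroup_iso_id : topgroup_iso (@idfun X).
Proof.
have idc : continuous (@idfun X) by move=> x; exact: cvg_id.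
by split=> //; split=> //; exists idfun.
Qed.

Lemma topgroup_iso_comp (f g : X -> X) :
  topgroup_iso f -> topgroup_iso g -> topgroup_iso (f \o g).
Proof.
move=> [fM [fc [f' [f'c fK f'K]]]] [gM [gc [g' [g'c gK g'K]]]]; split.
  by move=> x y /=; rewrite gM fM.
split; first by move=> x; apply: continuous_comp; [exact: gc|exact: fc].
exists (g' \o f'); split; [|exact: can_comp|exact: can_comp].
by move=> x; apply: continuous_comp; [exact: f'c|exact: g'c].
Qed.

Lemma topaut_inv_subproof f :
  {g : topaut X | cancel f g & cancel g f}.
Proof.
apply: cid2; case: f => f [fM [fc [g [gc fK gK]]]] /=.
suff gP : topgroup_iso g by exists (TopAut gP).
split; first by move=> x y; apply: (can_inj fK); rewrite fM !gK.
by split=> //; exists f.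
Qed.

Let one := TopAut topgroup_iso_id.
Let mul f g := TopAut (topgroup_iso_comp (topautP f) (topautP g)).
Let inv f := s2val (topaut_inv_subproof f).

Let mulA : associative mul. Proof. by move=> *; exact: topaut_ext. Qed.
Let mul1 : left_id one mul. Proof. by move=> *; exact: topaut_ext. Qed.
Let mulx1 : right_id one mul. Proof. by move=> *; exact: topaut_ext. Qed.
Let mulV : left_inverse one inv mul.
Proof.
by move=> f; apply: topaut_ext; exact: (s2valP (topaut_inv_subproof f)).
Qed.
Let mulxV : right_inverse one inv mul.
Proof.
by move=> f; apply: topaut_ext; exact: (s2valP' (topaut_inv_subproof f)).
Qed.

HB.instance Definition _ := isGroup.Build (topaut X) mulA mul1 mulx1 mulV mulxV.

Lemma topautM f g : (f * g : X -> X) = f \o g.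
Proof. by []. Qed.

End TopAutGroup.

Definition commutators (X : groupType) : set X :=
  [set z | exists x y, z = [~ x, y]].

Definition closed_derived (X : topGroupType) : subgroup X :=
  closure_subgroup (gen (@commutators X)).

Lemma closed_derived_sub (X : topGroupType) (f : X -> X) :
  {morph f : x y / x * y} -> continuous f ->
  forall y, carrier (closed_derived X) y -> carrier (closed_derived X) (f y).
Proof.
move=> fM fc.
have f1 : f 1 = 1 by apply: (@mulgI _ (f 1)); rewrite -fM !mulg1.
have fV x : f x^-1 = (f x)^-1.
  by apply: (@mulgI _ (f x)); rewrite -fM !mulgV.
have fgen y : carrier (gen (@commutators X)) y ->
    carrier (gen (@commutators X)) (f y).
  move=> gy H AH.
  have p1 : [set x | carrier H (f x)] 1 by rewrite /= f1; exact: sub1g.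
  have pM x z : [set x | carrier H (f x)] x -> [set x | carrier H (f x)] z ->
      [set x | carrier H (f x)] (x * z).
    by rewrite /= fM; exact: submg.
  have pV x : [set x | carrier H (f x)] x -> [set x | carrier H (f x)] x^-1.
    by rewrite /= fV; exact: subvg.
  apply: (gy (Subgroup p1 pM pV)) => _ [x [z ->]] /=; apply: AH.
  by exists (f x), (f z); rewrite /commg /conjg !fM !fV.
move=> y cy B /(fc y) fB.
by have [u [/fgen gu Bu]] := cy _ fB; exists (f u).
Qed.

Lemma lconj_continuous (X : topGroupType) (x : X) : continuous (lconj x).
Proof.
have mc (y z : X) : continuous (fun t : X => y * t * z).
  move=> t; apply: (@continuous_comp _ _ _ (fun t => (y * t, z))
    (fun xy : X * X => xy.1 * xy.2)); last exact: mulg_continuous.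
  apply: cvg_pair; last exact: cvg_cst.
  apply: (@continuous_comp _ _ _ (fun t => (y, t))
    (fun xy : X * X => xy.1 * xy.2)); last exact: mulg_continuous.
  by apply: cvg_pair; [exact: cvg_cst|exact: cvg_id].
exact: mc.
Qed.

Lemma closed_derived_normal (X : topGroupType) (x y : X) :
  carrier (closed_derived X) y -> carrier (closed_derived X) (lconj x y).
Proof.
by apply: closed_derived_sub; [exact: lconj_mul|exact: lconj_continuous].
Qed.

Definition abelianization (X : topGroupType) : preTopGroupType :=
  quotient (NormalSubgroup (@closed_derived_normal X)).

Definition ab_proj (X : topGroupType) : X -> abelianization X :=
  qproj (NormalSubgroup (@closed_derived_normal X)).

Section AbAut.
Variable X : topGroupType.
Implicit Types f g : X -> X.

Lemma ab_surj (q : abelianization X) : exists x, ab_proj x = q.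
Proof. by exists (qrepr q); exact: qreprK. Qed.

Lemma ab_projM : {morph @ab_proj X : x y / x * y}.
Proof. exact: qprojM. Qed.

Definition ab_fun f (q : abelianization X) : abelianization X :=
  ab_proj (f (qrepr q)).

Lemma ab_funE f : {morph f : x y / x * y} -> continuous f ->
  forall x, ab_fun f (ab_proj x) = ab_proj (f x).
Proof.
move=> fM fc x; apply/esym/qprojP => /=.
have f1 : f 1 = 1 by apply: (@mulgI _ (f 1)); rewrite -fM !mulg1.
rewrite (_ : (f x)^-1 = f x^-1); last first.
  by apply: (@mulgI _ (f x)); rewrite -fM !mulgV.
by rewrite -fM; apply: closed_derived_sub => //;
  exact: (@qproj_repr X (NormalSubgroup (@closed_derived_normal X))).
Qed.

Lemma ab_fun_iso f : topgroup_iso f -> topgroup_iso (ab_fun f).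
Proof.
move=> [fM [fc [g [gc fK gK]]]].
have gM : {morph g : x y / x * y}.
  by move=> x y; apply: (can_inj fK); rewrite fM !gK.
have ac h : {morph h : x y / x * y} -> continuous h -> continuous (ab_fun h).
  move=> hM hc; apply: quotient_cont.
  rewrite (_ : _ \o _ = @ab_proj X \o h); last first.
    by apply/funext => x; exact: ab_funE.
  by move=> x; apply: continuous_comp; [exact: hc|exact: qproj_continuous].
split.
  move=> p q; have [x <-] := ab_surj p; have [y <-] := ab_surj q.
  by rewrite -ab_projM !ab_funE// fM ab_projM.
split; first exact: ac.
exists (ab_fun g); split; first exact: ac.
  by move=> p; have [x <-] := ab_surj p; rewrite !ab_funE// fK.
by move=> p; have [x <-] := ab_surj p; rewrite !ab_funE// gK.
Qed.

Definition ab_aut (f : topaut X) : topaut (abelianization X) :=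
  TopAut (ab_fun_iso (topautP f)).

Lemma ab_autE (f : topaut X) x : ab_aut f (ab_proj x) = ab_proj (f x).
Proof. by case: f => f [fM [fc fV]]; exact: ab_funE. Qed.

End AbAut.

Section NormalizerAction.
Variables (X : topGroupType) (H : subgroup X).
Implicit Types n : [grp normalizer H].

Lemma normalizer_lconj n y : carrier H y -> carrier H (lconj (subgroup_val n) y).
Proof.
move=> Hy; have /= NH := subgroup_valP n.
by rewrite -NH; exists y.
Qed.

Definition conj_fun n (h : [grp H]) : [grp H] :=
  subgroup_in (normalizer_lconj n (subgroup_valP h)).

Lemma conj_fun_continuous n : continuous (conj_fun n).
Proof.
apply: continuous_subgroup => h.
apply: (@continuous_comp _ _ _ (@subgroup_val X H) (lconj (subgroup_val n))).
  exact: subgroup_val_continuous.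
exact: lconj_continuous.
Qed.

Lemma conj_fun_iso n : topgroup_iso (conj_fun n).
Proof.
split; first by move=> x y; apply: subgroup_val_inj; exact: lconj_mul.
split; first exact: conj_fun_continuous.
exists (conj_fun n^-1); split; first exact: conj_fun_continuous.
  by move=> h; apply: subgroup_val_inj; exact: lconjK.
by move=> h; apply: subgroup_val_inj; exact: lconjKV.
Qed.

Definition conj_aut n : topaut [grp H] := TopAut (conj_fun_iso n).

Definition conj_ab n : topaut (abelianization [grp H]) := ab_aut (conj_aut n).

Lemma conj_abM : {morph conj_ab : m n / m * n}.
Proof.
move=> m n; apply: topaut_ext => q; have [x <-] := ab_surj q.
rewrite topautM [RHS]/comp /conj_ab [in RHS](ab_autE _ x) !ab_autE; congr ab_proj.
by apply: subgroup_val_inj; exact: lconjM.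
Qed.

Definition in_normalizer_set : set [grp normalizer H] :=
  [set n | carrier H (subgroup_val n)].

Lemma in_normalizer1 : in_normalizer_set 1.
Proof. exact: sub1g. Qed.
Lemma in_normalizerM m n :
  in_normalizer_set m -> in_normalizer_set n -> in_normalizer_set (m * n).
Proof. exact: submg. Qed.
Lemma in_normalizerV n : in_normalizer_set n -> in_normalizer_set n^-1.
Proof. exact: subvg. Qed.

Definition in_normalizer : normal_subgroup [grp normalizer H] :=
  @NormalSubgroup _ (Subgroup in_normalizer1 in_normalizerM in_normalizerV)
    (fun m n => @normalizer_lconj m (subgroup_val n)).

End NormalizerAction.

Local Open Scope ring_scope.

Definition Zmod2_red (n : nat) (x : 'Z_(2 ^ n.+2)) : 'Z_(2 ^ n.+1) :=
  (x : nat)%:R.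

(** The inverse limit of the rings Z/2^(n+1), [n : nat]. *)
Record Z2 := MkZ2 {
  Z2_res :> forall n, 'Z_(2 ^ n.+1);
  Z2_resP : forall n, Zmod2_red (Z2_res n.+1) = Z2_res n
}.

Section Z2Ring.
Implicit Types x y z : Z2.

Lemma expn2_gt1 n : (1 < 2 ^ n.+1)%N.
Proof. by rewrite -{1}(expn0 2) ltn_exp2l. Qed.

Lemma Zmod2_red_mod n (k : nat) :
  (k %% (Zp_trunc (2 ^ n.+2)).+2)%:R = k%:R :> 'Z_(2 ^ n.+1).
Proof.
apply: val_inj; rewrite /= !val_Zp_nat ?expn2_gt1//.
by rewrite Zp_cast ?expn2_gt1// modn_dvdm// dvdn_exp2l.
Qed.

Lemma Zmod2_redD n : {morph @Zmod2_red n : x y / x + y}.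
Proof. by move=> x y; rewrite /Zmod2_red -natrD -[RHS]Zmod2_red_mod. Qed.

Lemma Zmod2_redM n : {morph @Zmod2_red n : x y / x * y}.
Proof. by move=> x y; rewrite /Zmod2_red -natrM -[RHS]Zmod2_red_mod. Qed.

Lemma Zmod2_red0 n : @Zmod2_red n 0 = 0.
Proof. by []. Qed.

Lemma Zmod2_red1 n : @Zmod2_red n 1 = 1.
Proof. exact: (Zmod2_red_mod n 1). Qed.

Lemma Zmod2_redN n : {morph @Zmod2_red n : x / - x}.
Proof.
by move=> x; apply: (addrI (Zmod2_red x)); rewrite -Zmod2_redD !subrr.
Qed.

Lemma Z2_ext x y : (forall n, x n = y n) -> x = y.
Proof.
case: x y => [x Px] [y Py] /= xy; have {}xy := functional_extensionality_dep xy.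
by rewrite xy in Px *; congr MkZ2; exact: Prop_irrelevance.
Qed.

HB.instance Definition _ := gen_eqMixin Z2.
HB.instance Definition _ := gen_choiceMixin Z2.

Let addP x y n : Zmod2_red (x n.+1 + y n.+1) = x n + y n.
Proof. by rewrite Zmod2_redD !Z2_resP. Qed.
Let mulP x y n : Zmod2_red (x n.+1 * y n.+1) = x n * y n.
Proof. by rewrite Zmod2_redM !Z2_resP. Qed.
Let oppP x n : Zmod2_red (- x n.+1) = - x n.
Proof. by rewrite Zmod2_redN Z2_resP. Qed.

Let zero := @MkZ2 (fun n => 0) (fun n => Zmod2_red0 n).
Let one := @MkZ2 (fun n => 1) (fun n => Zmod2_red1 n).
Let add x y := @MkZ2 (fun n => x n + y n) (addP x y).
Let opp x := @MkZ2 (fun n => - x n) (oppP x).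
Let mul x y := @MkZ2 (fun n => x n * y n) (mulP x y).

Let addA : associative add.
Proof. by move=> x y z; apply: Z2_ext => n; exact: addrA. Qed.
Let addC : commutative add.
Proof. by move=> x y; apply: Z2_ext => n; exact: addrC. Qed.
Let add0 : left_id zero add.
Proof. by move=> x; apply: Z2_ext => n; exact: add0r. Qed.
Let addN : left_inverse zero opp add.
Proof. by move=> x; apply: Z2_ext => n; exact: addNr. Qed.

HB.instance Definition _ := GRing.isZmodule.Build Z2 addA addC add0 addN.

Let mulA : associative mul.
Proof. by move=> x y z; apply: Z2_ext => n; exact: mulrA. Qed.
Let mulC : commutative mul.
Proof. by move=> x y; apply: Z2_ext => n; exact: mulrC. Qed.
Let mul1 : left_id one mul.
Proof. by move=> x; apply: Z2_ext => n; exact: mul1r. Qed.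
Let mulD : left_distributive mul add.
Proof. by move=> x y z; apply: Z2_ext => n; exact: mulrDl. Qed.
Let one_neq0 : one != zero.
Proof.
apply/eqP => /(congr1 (fun x : Z2 => x 0%N)) /= /eqP.
by rewrite oner_eq0.
Qed.

HB.instance Definition _ :=
  GRing.Zmodule_isComNzRing.Build Z2 mulA mulC mul1 mulD one_neq0.

Let unit : {pred Z2} := fun x => `[< exists y, y * x = 1 >].
Let inv x : Z2 :=
  if pselect (exists y, y * x = 1) is left ex then projT1 (cid ex) else x.

Let mulVx : {in unit, left_inverse 1 inv *%R}.
Proof.
move=> x; rewrite /in_mem /= => /asboolP ex; rewrite /inv.
by case: pselect => // ex'; exact: projT2 (cid ex').
Qed.
Let unitPl x y : y * x = 1 -> unit x.
Proof. by move=> yx; apply/asboolP; exists y. Qed.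
Let inv_out : {in [predC unit], inv =1 id}.
Proof.
move=> x; rewrite inE /in_mem /= => /asboolPn nex; rewrite /inv.
by case: pselect.
Qed.

HB.instance Definition _ :=
  GRing.ComNzRing_hasMulInverse.Build Z2 mulVx unitPl inv_out.

Lemma Z2_resD x y n : (x + y) n = x n + y n. Proof. by []. Qed.
Lemma Z2_resN x n : (- x) n = - x n. Proof. by []. Qed.
Lemma Z2_resM x y n : (x * y) n = x n * y n. Proof. by []. Qed.

End Z2Ring.

Section Z2Topology.

(** The residue mod 2^(n+1) determines all the earlier ones, so the sets
    [[set y | y n = x n]] form a basis of neighbourhoods of [x] for the
    inverse limit of the discrete topologies. *)
Definition Z2_nbhs (x : Z2) : set_system Z2 :=
  filter_from [set: nat] (fun n => [set y : Z2 | y n = x n]).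

Lemma Z2_res_eq (x y : Z2) m n : (m <= n)%N -> x n = y n -> x m = y m.
Proof.
elim: n => [|n IH].
  by rewrite leqn0 => /eqP ->.
rewrite leq_eqVlt => /orP[/eqP-> //|mn xy]; apply: IH => //.
by rewrite -(Z2_resP x) -(Z2_resP y) xy.
Qed.

Lemma Z2_nbhs_filter x : ProperFilter (Z2_nbhs x).
Proof.
apply: filter_from_proper; last by move=> n _; exists x.
apply: filter_from_filter; first by exists 0%N.
move=> m n _ _; exists (maxn m n) => // y /= yx.
by split; apply: Z2_res_eq yx; rewrite (leq_maxl, leq_maxr).
Qed.

Lemma Z2_nbhs_singleton x (A : set Z2) : Z2_nbhs x A -> A x.
Proof. by move=> [n _]; exact. Qed.

Lemma Z2_nbhs_nbhs x (A : set Z2) : Z2_nbhs x A -> Z2_nbhs x (Z2_nbhs^~ A).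
Proof.
move=> [n _ nA]; exists n => // y /= yx; exists n => // z /= zy.
by apply: nA; rewrite /= zy.
Qed.

HB.instance Definition _ := hasNbhs.Build Z2 Z2_nbhs.
HB.instance Definition _ := Nbhs_isNbhsTopological.Build Z2
  Z2_nbhs_filter Z2_nbhs_singleton Z2_nbhs_nbhs.

End Z2Topology.

HB.instance Definition _ (I : finType) (T : topologicalType) :=
  Topological.copy {ffun I -> T}
    (initial_topology (fun f : {ffun I -> T} => (f : prod_topology (fun _ : I => T)))).

Definition units (R : comUnitRingType) : Type :=
  {x : R | x \is a GRing.unit}.

Section Units.
Variable R : comUnitRingType.

HB.instance Definition _ := [isSub of units R for @sval R _].
HB.instance Definition _ := [Choice of units R by <:].

Let one : units R := exist _ 1 (unitr1 R).
Let mul_proof (x y : units R) : val x * val y \is a GRing.unit.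
Proof. by rewrite unitrM !(valP x, valP y). Qed.
Let mul (x y : units R) : units R := exist _ (val x * val y) (mul_proof x y).
Let inv_proof (x : units R) : (val x)^-1 \is a GRing.unit.
Proof. by rewrite unitrV (valP x). Qed.
Let inv (x : units R) : units R := exist _ (val x)^-1 (inv_proof x).

Let mulA : associative mul.
Proof. by move=> x y z; apply: val_inj; apply: mulrA. Qed.
Let mul1 : left_id one mul.
Proof. by move=> x; apply: val_inj; apply: mul1r. Qed.
Let mulx1 : right_id one mul.
Proof. by move=> x; apply: val_inj; apply: mulr1. Qed.
Let mulV : left_inverse one inv mul.
Proof. by move=> x; apply: val_inj; apply: mulVr; exact: valP. Qed.
Let mulxV : right_inverse one inv mul.
Proof. by move=> x; apply: val_inj; apply: mulrV; exact: valP. Qed.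

HB.instance Definition _ := isGroup.Build (units R) mulA mul1 mulx1 mulV mulxV.

End Units.

HB.instance Definition _ := Topological.copy (units Z2)
  (initial_topology (val : units Z2 -> Z2)).

HB.instance Definition _ (I : finType) (G : preTopGroupType) :=
  Group.on {ffun I -> G}.

Local Open Scope group_scope.

(** The letters 0 and 1 are [false] and [true]. *)
Definition word := seq bool.

Definition adjacent (s t : word) : Prop :=
  exists b, t = rcons s b \/ s = rcons t b.

Definition tree_aut (f : word -> word) : Prop :=
  [/\ bijective f, f [::] = [::] &
      forall s t, adjacent s t <-> adjacent (f s) (f t)].

(** The group law, defined below, is [(u * v) t = u (v t)]. *)
Record W := MkW { W_fun :> word -> word; W_aut : tree_aut W_fun }.

Section WGroup.
Implicit Types u v w : W.

HB.instance Definition _ := gen_eqMixin W.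
HB.instance Definition _ := gen_choiceMixin W.

Lemma W_ext u v : (u : word -> word) =1 v -> u = v.
Proof.
case: u v => [f Pf] [g Pg] /= /funext fg; rewrite fg in Pf *.
by congr MkW; exact: Prop_irrelevance.
Qed.

Lemma W_nil w : w [::] = [::].
Proof. by case: w => f []. Qed.

Lemma W_inj w : injective w.
Proof. by case: w => f [fb _ _] /=; exact: bij_inj. Qed.

Lemma W_adj w s t : adjacent s t <-> adjacent (w s) (w t).
Proof. by have [_ _ fP] := W_aut w; exact: (fP s t). Qed.

Lemma W_size w t : size (w t) = size t.
Proof.
have wadj s c : adjacent (w s) (w (rcons s c)).
  by apply: (W_adj w s _).1; exists c; left.
have [n] := ubnP (size t); elim: n t => // n IH t; case/lastP: t => [|t b].
  by rewrite W_nil.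
rewrite size_rcons ltnS => tn; have wt := IH t tn.
have [c] := wadj t b; case=> [->|tb]; first by rewrite size_rcons wt.
case/lastP: t => [|s d] in tn wt tb *.
  by move: tb; rewrite W_nil => /(congr1 size); rewrite size_rcons.
rewrite size_rcons in tn wt; have ws := IH s (ltnW tn).
have [e [sd|sd]] := wadj s d; last first.
  by move: (congr1 size sd); rewrite size_rcons wt ws => /eqP;
    rewrite -addn2 -{1}[size s]addn0 eqn_add2l.
move: tb; rewrite sd => /rcons_inj[/W_inj sE _].
by move: (congr1 size sE); rewrite !size_rcons => /eqP;
  rewrite -addn2 -{1}[size s]addn0 eqn_add2l.
Qed.

Lemma tree_aut_id : tree_aut id.
Proof. by split => //; exists id. Qed.

Lemma tree_aut_comp u v : tree_aut (u \o v).
Proof.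
case: u v => [f [fb f0 fP]] [g [gb g0 gP]]; split=> /=.
- exact: bij_comp.
- by rewrite g0 f0.
- by move=> s t; apply: (iff_trans (gP s t)); exact: fP.
Qed.

Lemma W_inv_subproof w : {v : W | cancel w v & cancel v w}.
Proof.
apply: cid2; case: w => f [[g fK gK] f0 fP] /=.
suff gP : tree_aut g by exists (MkW gP).
split; first by exists f.
  by rewrite -[in LHS]f0 fK.
by move=> s t; have := fP (g s) (g t); rewrite !gK => h; split=> /h.
Qed.

Let one := MkW tree_aut_id.
Let mul u v := MkW (tree_aut_comp u v).
Let inv w := s2val (W_inv_subproof w).

Let mulA : associative mul. Proof. by move=> *; exact: W_ext. Qed.
Let mul1 : left_id one mul. Proof. by move=> *; exact: W_ext. Qed.
Let mulx1 : right_id one mul. Proof. by move=> *; exact: W_ext. Qed.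
Let mulV : left_inverse one inv mul.
Proof. by move=> w; apply: W_ext; exact: (s2valP (W_inv_subproof w)). Qed.
Let mulxV : right_inverse one inv mul.
Proof. by move=> w; apply: W_ext; exact: (s2valP' (W_inv_subproof w)). Qed.

HB.instance Definition _ := isGroup.Build W mulA mul1 mulx1 mulV mulxV.

Lemma W1E t : (1 : W) t = t. Proof. by []. Qed.
Lemma WME u v t : (u * v) t = u (v t). Proof. by []. Qed.
Lemma WVK w : cancel w (w^-1)%g. Proof. by move=> t; rewrite -WME mulVg. Qed.
Lemma WKV w : cancel (w^-1)%g w. Proof. by move=> t; rewrite -WME mulgV. Qed.

End WGroup.

Section WTopology.

(** The inverse limit of the discrete topologies on the [Aut(T_n)], where [T_n]
    consists of the words of length at most [n]. *)
Definition W_nbhs (w : W) : set_system W :=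
  filter_from [set: nat]
    (fun n => [set v : W | forall t, (size t <= n)%N -> v t = w t]).

Lemma W_nbhs_filter w : ProperFilter (W_nbhs w).
Proof.
apply: filter_from_proper; last by move=> n _; exists w.
apply: filter_from_filter; first by exists 0%N.
move=> m n _ _; exists (maxn m n) => // v /= vw.
by split=> t tn; apply: vw; rewrite leq_max tn ?orbT.
Qed.

Lemma W_nbhs_singleton w (A : set W) : W_nbhs w A -> A w.
Proof. by move=> [n _]; exact. Qed.

Lemma W_nbhs_nbhs w (A : set W) : W_nbhs w A -> W_nbhs w (W_nbhs^~ A).
Proof.
move=> [n _ nA]; exists n => // v /= vw; exists n => // u /= uv.
by apply: nA => t tn; rewrite uv// vw.
Qed.

HB.instance Definition _ := hasNbhs.Build W W_nbhs.
HB.instance Definition _ := Nbhs_isNbhsTopological.Build W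
  W_nbhs_filter W_nbhs_singleton W_nbhs_nbhs.

Let mul_cont : continuous (fun uv : W * W => uv.1 * uv.2).
Proof.
move=> [u v] A /= [n _ nA].
exists ([set u' : W | forall t, (size t <= n)%N -> u' t = u t],
        [set v' : W | forall t, (size t <= n)%N -> v' t = v t]) => /=.
  by split; exists n.
move=> [u' v'] /= [u'u v'v]; apply: nA => t tn /=.
by change (u' (v' t) = u (v t)); rewrite v'v// u'u// W_size.
Qed.

Let inv_cont : continuous (fun w : W => w^-1).
Proof.
move=> w A /= [n _ nA]; exists n => // v /= vw; apply: nA => t tn /=.
by apply: (@W_inj v); rewrite WKV vw ?WKV// W_size.
Qed.

HB.instance Definition _ :=
  PreTopologicalGroup_isTopologicalGroup.Build W mul_cont inv_cont.

End WTopology.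

Definition pair_fun (f g : word -> word) (s : word) : word :=
  if s is b :: t then b :: (if b then g t else f t) else [::].

Definition swap_fun (s : word) : word :=
  if s is b :: t then ~~ b :: t else [::].

Lemma adjacent_nil (s : word) : adjacent [::] s <-> size s = 1%N.
Proof.
split=> [[b [->//|/(congr1 size)]]|]; first by rewrite size_rcons.
by case: s => [//|b [|//]] _; exists b; left.
Qed.

Lemma adjacent_sym (s t : word) : adjacent s t -> adjacent t s.
Proof. by move=> [b [|] h]; exists b; [right|left]. Qed.

Lemma adjacent_cons b c (s t : word) :
  adjacent (b :: s) (c :: t) <-> b = c /\ adjacent s t.
Proof.
split=> [[d []]|[<- [d [->|->]]]].
- by move=> /= -[-> ->]; split=> //; exists d; left.
- by move=> /= -[-> ->]; split=> //; exists d; right.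
- by exists d; left.
- by exists d; right.
Qed.

Lemma tree_aut_pair (u v : W) : tree_aut (pair_fun u v).
Proof.
have psize s : size (pair_fun u v s) = size s.
  by case: s => [|[] s] //=; rewrite W_size.
split=> //.
  by exists (pair_fun (u^-1)%g (v^-1)%g) => -[|[] s] //=; rewrite ?WVK ?WKV.
case=> [|b s] [|c t] //.
- by rewrite -[pair_fun u v [::]]/[::] !adjacent_nil psize.
- by split=> /adjacent_sym /adjacent_nil h; apply/adjacent_sym/adjacent_nil;
    move: h; rewrite psize.
rewrite /= !adjacent_cons; split=> -[<-{c} st]; split=> //; move: st;
  by case: b => /=; rewrite -W_adj.
Qed.

(** The automorphism (u, v), which acts by [u] below the vertex 0 and by [v]
    below the vertex 1. *)
Definition wpair (u v : W) : W := MkW (tree_aut_pair u v).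

Lemma tree_aut_swap : tree_aut swap_fun.
Proof.
have ssize s : size (swap_fun s) = size s by case: s.
split=> //.
  by exists swap_fun => -[|b s] //=; rewrite negbK.
case=> [|b s] [|c t] //.
- by rewrite -[swap_fun [::]]/[::] !adjacent_nil ssize.
- by split=> /adjacent_sym /adjacent_nil h; apply/adjacent_sym/adjacent_nil;
    move: h; rewrite ssize.
rewrite /= !adjacent_cons; split=> -[bc st]; split=> //.
  by rewrite bc.
exact: negb_inj.
Qed.

Definition sigma : W := MkW tree_aut_swap.

Definition closed_gen (I : Type) (a : I -> W) : subgroup W :=
  closure_subgroup (gen (range a)).

Lemma mem_closed_gen (I : Type) (a : I -> W) (i : I) :
  carrier (closed_gen a) (a i).
Proof.
have ga : carrier (gen (range a)) (a i) by move=> H aH; apply: aH; exists i.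
exact: (@subset_closure _ (carrier (gen (range a))) (a i) ga).
Qed.

Definition closed_gen_elt (I : Type) (a : I -> W) (i : I) :
  [grp closed_gen a] := subgroup_in (@mem_closed_gen I a i).

(** Indices are shifted to [0, ..., r-1] and [ord_pred] is the cyclic
    predecessor, which takes 0 to r-1. *)
Definition periodic_recursion (r : nat) (a : 'I_r -> W) : Prop :=
  forall i : 'I_r,
    a i = if val i == 0%N then wpair (a (ord_pred i)) 1 * sigma
          else wpair (a (ord_pred i)) 1.

Definition Z2_basis (r : nat) (i : 'I_r) : {ffun 'I_r -> Z2} :=
  [ffun j => ((j == i)%:R)%R].

Definition coord_mul (r : nat) (c : {ffun 'I_r -> units Z2})
    (x : {ffun 'I_r -> Z2}) : {ffun 'I_r -> Z2} :=
  [ffun i => (val (c i) * x i)%R].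

(* Main.v *)
Require Import Defs.
From HB Require Import structures.
From mathcomp Require Import all_boot all_algebra ring.
From mathcomp Require Import mathcomp_extra boolp classical_sets functions.
From mathcomp Require Import topology.

(** An automorphism [w] of the tree is determined by [flip w], which tells
    whether it exchanges the letters 0 and 1, and by its two sections [w_0] and
    [w_1]. Count the indices from 0 and let [p = r - 1]. The recursion
      [chi_0 w = flip w + 2 chi_p w_0],  [chi_(i+1) w = chi_i w_0 + chi_i w_1]
    defines continuous maps [W -> Z_2] with [chi_i (a_j) = (i == j)]. They are
    additive on the closed subgroup of the automorphisms all of whose sections
    are balanced, i.e. satisfy [chi_p w_1 = chi_p w_0 + flip w]. This subgroup
    contains [G], and the [chi_i] are the coordinates on the abelianization.
    Moreover [w] is in [G] as soon as it is balanced with both sections in [G].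

    If [w] normalizes [G], then so does [u = w_0], and the matrix of [w] on the
    abelianization is that of [u] shifted cyclically along the diagonal. As
    [w a_j w^-1] is balanced, the first row of the matrix vanishes off the
    diagonal, so by shifting the matrix is diagonal. If it is the identity, then
    [chi_p (w_1 w_0^-1) = flip w], and [w] is approximated by elements of [G]
    level by level. Conversely, a diagonal matrix [k] of units is realised by
    the solution of [w(k) = (u, a_p^((k_0 - 1)/2) u)] with [u = w(shift k)]. *)

Set Implicit Arguments.
Unset Strict Implicit.
Unset Printing Implicit Defensive.

Import GRing.Theory.
Local Open Scope classical_set_scope.
Local Open Scope group_scope.

(** * Sections of tree automorphisms *)

Section Sections.
Implicit Types (u v w : W) (b : bool) (s t : word).

(** Adjacency leaves the parent or a child of [w t], and preservation of length excludes the
    parent. *)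
Lemma W_rcons w t b : exists c, w (rcons t b) = rcons (w t) c.
Proof.
have /(W_adj w) [c [->|tE]] : adjacent t (rcons t b) by exists b; left.
  by exists c.
move: (congr1 size tE) => /eqP.
by rewrite size_rcons !W_size size_rcons -addn2 -[X in X == _]addn0 eqn_add2l.
Qed.

Lemma W_cat w s t : take (size s) (w (s ++ t)) = w s.
Proof.
elim/last_ind: t => [|t b IH]; first by rewrite cats0 take_oversize ?W_size.
have [d] := W_rcons w (s ++ t) b; rewrite rcons_cat => ->.
by rewrite -cats1 takel_cat ?IH// W_size size_cat leq_addr.
Qed.

(** The default of [head] is never reached, as [w [:: false]] has length 1. *)
Definition flip w : bool := head false (w [:: false]).

Definition sec_fun w b t : word := behead (w (b :: t)).

Lemma W_cons_head w b t : w (b :: t) = head false (w [:: b]) :: sec_fun w b t.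
Proof.
have := W_cat w [:: b] t; rewrite /sec_fun.
have := W_size w [:: b]; have := W_size w (b :: t).
case: (w [:: b]) => [|c [|//]]//; case: (w (b :: t)) => [|d x]//= _ _.
by rewrite take0 => -[->].
Qed.

Lemma W_letter w b : w [:: b] = [:: b (+) flip w].
Proof.
have h c : w [:: c] = [:: head false (w [:: c])].
  have := W_size w [:: c]; by case: (w [:: c]) => [|? []].
rewrite h; congr [:: _]; case: b; rewrite /flip //=.
have: w [:: true] <> w [:: false] by move/W_inj.
by rewrite h (h false); move: (head _ _) (head _ _) => [] [].
Qed.

Lemma W_consE w b t : w (b :: t) = b (+) flip w :: sec_fun w b t.
Proof. by rewrite W_cons_head W_letter. Qed.

Lemma flipV w : flip w^-1 = flip w.
Proof.
have := WVK w [:: false]; rewrite !W_letter /=.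
by case; move: (flip w) (flip w^-1) => [] [].
Qed.

Lemma sec_funVK w b : cancel (sec_fun w b) (sec_fun w^-1 (b (+) flip w)).
Proof.
move=> t; have := WVK w (b :: t).
by rewrite W_consE W_consE => -[].
Qed.

Lemma tree_aut_sec w b : tree_aut (sec_fun w b).
Proof.
split.
- exists (sec_fun w^-1 (b (+) flip w)); first exact: sec_funVK.
  move=> t; have := @sec_funVK w^-1 (b (+) flip w) t.
  by rewrite flipV addbK invgK.
- by rewrite /sec_fun W_letter.
move=> s t; have := W_adj w (b :: s) (b :: t); rewrite !W_consE !adjacent_cons.
by move=> h; split=> st; [case: (h.1 (conj erefl st))
                         |case: (h.2 (conj erefl st))].
Qed.

Definition sec w b : W := MkW (tree_aut_sec w b).

Lemma W_cons w b t : w (b :: t) = b (+) flip w :: sec w b t.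
Proof. exact: W_consE. Qed.

Lemma flip1 : flip 1 = false. Proof. by []. Qed.

Lemma sec1 b : sec 1 b = 1.
Proof. exact: W_ext. Qed.

Lemma flipM u v : flip (u * v) = flip u (+) flip v.
Proof.
have := WME u v [:: false]; rewrite !W_letter => -[]/=.
by rewrite addbC.
Qed.

Lemma secM u v b : sec (u * v) b = sec u (b (+) flip v) * sec v b.
Proof.
apply: W_ext => t; have := WME u v (b :: t); rewrite !W_cons => -[] _.
by rewrite WME.
Qed.

Lemma secV w b : sec w^-1 b = (sec w (b (+) flip w))^-1.
Proof.
apply: (@mulIg _ (sec w (b (+) flip w))); rewrite mulVg.
by rewrite -{1}[b](addbK (flip w)) -secM mulVg sec1.
Qed.

(** [u] and [v] are the sections at the letters 0 and 1; as the flip comes first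
    in [(x, y) sigma], the section of the latter at 0 is [y]. *)
Definition mk b u v : W := if b then wpair v u * sigma else wpair u v.

Lemma mkE b u v c t :
  mk b u v (c :: t) = c (+) b :: (if c then v else u) t.
Proof.
by rewrite /mk; case: b => //; rewrite ?WME /=; case: c.
Qed.

Lemma flip_mk b u v : flip (mk b u v) = b.
Proof. by rewrite /flip mkE. Qed.

Lemma sec_mk b u v c : sec (mk b u v) c = if c then v else u.
Proof. by apply: W_ext => t; rewrite /= /sec_fun mkE. Qed.

Lemma W_eta w : w = mk (flip w) (sec w false) (sec w true).
Proof.
apply: W_ext => -[|b t]; first by rewrite !W_nil.
by rewrite mkE W_cons; case: b.
Qed.

Lemma W_eq u v : flip u = flip v -> sec u false = sec v false ->
  sec u true = sec v true -> u = v.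
Proof. by move=> e0 e1 e2; rewrite (W_eta u) e0 e1 e2 -W_eta. Qed.

(** Equality of the images in the finite group [Aut(T_n)]. *)
Definition agree n u v : Prop := forall t, (size t <= n)%N -> u t = v t.

Lemma agree_sym n u v : agree n u v -> agree n v u.
Proof. by move=> uv t tn; rewrite uv. Qed.

Lemma agree_trans n u v w : agree n u v -> agree n v w -> agree n u w.
Proof. by move=> uv vw t tn; rewrite uv// vw. Qed.

Lemma agree_leq m n u v : (m <= n)%N -> agree n u v -> agree m u v.
Proof. by move=> mn uv t tm; rewrite uv// (leq_trans tm). Qed.

Lemma agree_eq u v : (forall n, agree n u v) -> u = v.
Proof. by move=> uv; apply: W_ext => t; exact: (uv (size t)). Qed.

Lemma agreeM n u u' v v' :
  agree n u u' -> agree n v v' -> agree n (u * v) (u' * v').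
Proof. by move=> uu vv t tn; rewrite !WME vv// uu// W_size. Qed.

Lemma agreeV n u v : agree n u v -> agree n u^-1 v^-1.
Proof.
by move=> uv t tn; apply: (@W_inj u); rewrite WKV uv ?WKV// W_size.
Qed.

Lemma agree0 u v : agree 0 u v.
Proof. by move=> t; rewrite leqn0 size_eq0 => /eqP->; rewrite !W_nil. Qed.

Lemma agree_flip n u v : agree n.+1 u v -> flip u = flip v.
Proof. by move=> uv; rewrite /flip uv. Qed.

Lemma agree_sec n u v b : agree n.+1 u v -> agree n (sec u b) (sec v b).
Proof. by move=> uv t tn; rewrite /= /sec_fun uv. Qed.

Lemma agree_cons n u v : flip u = flip v ->
  (forall b, agree n (sec u b) (sec v b)) -> agree n.+1 u v.
Proof.
move=> fe se [|b t] tn; first by rewrite !W_nil.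
by rewrite !W_cons fe se.
Qed.

(** The value at a word [t] is stable from the index [size t] on; two words can be compared at one
    common index. *)
Lemma W_complete (s : nat -> W) : (forall n, agree n (s n.+1) (s n)) ->
  {w : W | forall n, agree n w (s n)}.
Proof.
move=> sS; have sle m n : (m <= n)%N -> agree m (s n) (s m).
  elim: n => [|n IH]; first by rewrite leqn0 => /eqP->.
  rewrite leq_eqVlt => /orP[/eqP->//|mn].
  by apply: agree_trans (IH mn); exact: agree_leq (sS n).
pose f t := s (size t) t.
have fE n t : (size t <= n)%N -> f t = s n t by move=> /sle ->.
suff fP : tree_aut f by exists (MkW fP) => n t /fE.
split.
- exists (fun t => (s (size t))^-1 t) => t; rewrite /f.
    by rewrite W_size WVK.
  by rewrite W_size WKV.
- by rewrite /f W_nil.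
move=> x y; rewrite (fE (maxn (size x) (size y)) x) ?leq_maxl//.
by rewrite (fE (maxn (size x) (size y)) y) ?leq_maxr//; exact: W_adj.
Qed.

Lemma flipX w n : flip w = false -> flip (w ^+ n) = false.
Proof. by move=> fw; elim: n => [//|n fn]; rewrite expgS flipM fw fn. Qed.

Lemma secX w n b : flip w = false -> sec (w ^+ n) b = sec w b ^+ n.
Proof.
move=> fw; elim: n => [|n IH]; first by rewrite !expg0 sec1.
by rewrite !expgS secM flipX// addbF IH.
Qed.

(** A square does not flip, so its powers are taken section by section, and each level of the tree
    costs one factor 2. *)
Lemma agree_expg2n n w : agree n (w ^+ (2 ^ n)%N) 1.
Proof.
elim: n w => [|n IH] w; first exact: agree0.
have f2 : flip (w ^+ 2) = false by rewrite expg2 flipM addbb.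
rewrite expnS expgnA; apply: agree_cons => [|b]; first by rewrite flipX.
by rewrite secX// sec1.
Qed.

Lemma closureW (A : set W) w :
  closure A w <-> forall n, exists2 v, A v & agree n v w.
Proof.
split=> [Aw n|Aw B [n _ nB]].
  have /Aw [v [Av vw]] : nbhs w [set v | agree n v w] by exists n.
  by exists v.
by have [v Av vw] := Aw n; exists v; split=> //; exact: nB.
Qed.

End Sections.

Arguments mk : simpl never.

(** * Arithmetic of 2-adic integers *)

Section Z2Arithmetic.
Local Open Scope ring_scope.
Implicit Types x y z : Z2.

Lemma val_natZ2 n m : (m%:R : 'Z_(2 ^ n.+1)) = (m %% 2 ^ n.+1)%N :> nat.
Proof. by rewrite val_Zp_nat ?expn2_gt1. Qed.

Lemma ltn_Z2_res x n : (x n < 2 ^ n.+1)%N.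
Proof. by apply: leq_trans (ltn_ord (x n)) _; rewrite Zp_cast ?expn2_gt1. Qed.

Lemma val_Z2_leq x m n : (m <= n)%N -> x m = (x n %% 2 ^ m.+1)%N :> nat.
Proof.
elim: n => [|n IH].
  by rewrite leqn0 => /eqP->; rewrite modn_small ?ltn_Z2_res.
rewrite leq_eqVlt => /orP[/eqP->|]; first by rewrite modn_small ?ltn_Z2_res.
rewrite ltnS => mn; rewrite IH// -(Z2_resP x n) val_natZ2 modn_dvdm//.
by rewrite dvdn_exp2l.
Qed.

Lemma Z2_res_natr m n : (m%:R : Z2) n = m%:R.
Proof. by elim: m => [//|m IH]; rewrite !mulrSr Z2_resD IH. Qed.

Lemma natr_Z2_res n (u : 'Z_(2 ^ n.+1)) : (u : nat)%:R = u.
Proof. exact: natr_Zp. Qed.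

Lemma val_Z2D x y n : (x + y) n = ((x n + y n) %% 2 ^ n.+1)%N :> nat.
Proof.
rewrite Z2_resD -[X in (X + _)%R]natr_Z2_res -[X in (_ + X)%R]natr_Z2_res.
by rewrite -natrD val_natZ2.
Qed.

Lemma val_Z2_double x n : (x *+ 2) n.+1 = (x n).*2 :> nat.
Proof.
rewrite mulr2n val_Z2D addnn -muln2.
by rewrite (@val_Z2_leq x n n.+1)// -[RHS]muln2 muln_modl -expnSr.
Qed.

(** As [x n] is the residue modulo [2^(n+1)], this is congruence modulo [2^k], void for [k = 0]. *)
Definition Z2_cong k x y : Prop := forall n, (n < k)%N -> x n = y n.

Lemma Z2_cong_eq x y : (forall k, Z2_cong k x y) -> x = y.
Proof. by move=> xy; apply: Z2_ext => n; exact: (xy n.+1). Qed.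

Lemma Z2_cong_refl k x : Z2_cong k x x. Proof. by []. Qed.

Lemma Z2_cong_sym k x y : Z2_cong k x y -> Z2_cong k y x.
Proof. by move=> xy n nk; rewrite xy. Qed.

Lemma Z2_cong_trans k x y z : Z2_cong k x y -> Z2_cong k y z -> Z2_cong k x z.
Proof. by move=> xy yz n nk; rewrite xy// yz. Qed.

Lemma Z2_congD k x x' y y' :
  Z2_cong k x x' -> Z2_cong k y y' -> Z2_cong k (x + y) (x' + y').
Proof. by move=> xx yy n nk; rewrite !Z2_resD xx// yy. Qed.

Lemma Z2_congN k x y : Z2_cong k x y -> Z2_cong k (- x) (- y).
Proof. by move=> xy n nk; rewrite !Z2_resN xy. Qed.

Lemma Z2_congM k x x' y y' :
  Z2_cong k x x' -> Z2_cong k y y' -> Z2_cong k (x * y) (x' * y').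
Proof. by move=> xx yy n nk; rewrite !Z2_resM xx// yy. Qed.

Lemma Z2_cong_leq j k x y : (j <= k)%N -> Z2_cong k x y -> Z2_cong j x y.
Proof. by move=> jk xy n nj; rewrite xy// (leq_trans nj). Qed.

Lemma Z2_congS_res n x y : Z2_cong n.+1 x y <-> x n = y n.
Proof. by split=> [xy|xy m mn]; [exact: xy|exact: Z2_res_eq xy]. Qed.

(** The factor 2 gains one binary digit; this makes the recursion for [chi] converge and its
    inductions close up. *)
Lemma Z2_cong_double k x y : Z2_cong k x y -> Z2_cong k.+1 (x *+ 2) (y *+ 2).
Proof.
move=> xy [|n] nk; last by apply: ord_inj; rewrite !val_Z2_double xy.
have d0 z : (z *+ 2) 0%N = 0.
  by apply: ord_inj; rewrite mulr2n val_Z2D addnn -muln2 modnMl.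
by rewrite !d0.
Qed.

Lemma Z2_double_inj x y : x *+ 2 = y *+ 2 -> x = y.
Proof.
move=> xy; apply: Z2_ext => n; apply: ord_inj; apply: double_inj.
by rewrite -!val_Z2_double xy.
Qed.

Lemma Z2_cong_natr x n : Z2_cong n.+1 x (x n : nat)%:R.
Proof. by apply/Z2_congS_res; rewrite Z2_res_natr natr_Z2_res. Qed.

Lemma Z2_half_subproof x n :
  Zmod2_red (((x n.+2)./2)%:R : 'Z_(2 ^ n.+2)) = ((x n.+1)./2)%:R.
Proof.
apply: ord_inj; rewrite /Zmod2_red /= val_natZ2 [in LHS]val_natZ2.
rewrite modn_dvdm ?dvdn_exp2l//.
rewrite val_natZ2 (@val_Z2_leq x n.+1 n.+2)// -!divn2 !modn_divl -expnSr.
by rewrite modn_mod.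
Qed.

(** The 2-adic number obtained by dropping the lowest digit; each residue is computed from the next
    residue of [x]. *)
Definition Z2_half x : Z2 := MkZ2 (Z2_half_subproof x).

Lemma Z2_halfK x : x = (odd (x 0%N))%:R + Z2_half x *+ 2.
Proof.
apply: Z2_ext => n; rewrite mulr2n !Z2_resD Z2_res_natr -!natrD addnn.
rewrite (@val_Z2_leq x 0 n.+1)// modn2 oddb odd_double_half.
by apply: ord_inj; rewrite val_natZ2 -(@val_Z2_leq x n n.+1).
Qed.

Lemma Z2_cong_half k x y :
  Z2_cong k.+1 x y -> Z2_cong k (Z2_half x) (Z2_half y).
Proof. by move=> xy n nk /=; rewrite xy. Qed.

Lemma Z2_unit_odd x : x \is a GRing.unit -> odd (x 0%N).
Proof.
move=> /mulrV /(congr1 (fun z : Z2 => z 0%N)); rewrite Z2_resM.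
by case: (x 0%N) => -[|[|]].
Qed.

Lemma Z2_complete (s : nat -> Z2) : (forall k, Z2_cong k (s k.+1) (s k)) ->
  {x : Z2 | forall k, Z2_cong k x (s k)}.
Proof.
move=> sS; have sP n : Zmod2_red (s n.+2 n.+1) = s n.+1 n.
  by rewrite Z2_resP; exact: sS.
exists (MkZ2 sP); case=> [//|k]; exact/Z2_congS_res.
Qed.

Lemma nbhs_Z2 x (A : set Z2) :
  nbhs x A <-> exists n, forall y, Z2_cong n y x -> A y.
Proof.
split=> [[n _ nA]|[n nA]].
  by exists n.+1 => y /Z2_congS_res yx; exact: nA.
by exists n => // y /= /Z2_congS_res yx; apply: nA; exact: Z2_cong_leq yx.
Qed.

End Z2Arithmetic.

(** * Powers with 2-adic exponents *)

Section WPowers.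
Implicit Types (g w : W) (x y z : Z2).

(** The period [2^n] at level [n] divides [2^(n+1)], the modulus of the residue [z n] that serves as
    exponent below. *)
Lemma agree_expg_mod g n m : agree n (g ^+ (m %% 2 ^ n.+1)) (g ^+ m).
Proof.
rewrite [X in agree _ _ (_ ^+ X)](divn_eq m (2 ^ n.+1)) expgnDr.
rewrite -[X in agree _ X _]mul1g; apply: agreeM => //; apply: agree_sym.
rewrite mulnC expgnA expnSr expgnA; elim: (m %/ _)%N => [//|k IH].
rewrite expgS -[X in agree _ _ X]mul1g; apply: agreeM => //.
rewrite -[X in agree _ _ X](expg1n _ 2).
by rewrite !expg2; apply: agreeM; exact: agree_expg2n.
Qed.

Lemma W_pow_subproof g z n :
  agree n (g ^+ (z n.+1 : nat)) (g ^+ (z n : nat)).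
Proof.
by rewrite (@val_Z2_leq z n n.+1)//; apply: agree_sym; exact: agree_expg_mod.
Qed.

Definition W_pow g z : W :=
  sval (@W_complete (fun n => g ^+ (z n : nat)) (W_pow_subproof g z)).

Lemma agree_W_pow g z n : agree n (W_pow g z) (g ^+ (z n : nat)).
Proof. by rewrite /W_pow; case: W_complete. Qed.

Lemma W_powD g y z : W_pow g (y + z)%R = W_pow g y * W_pow g z.
Proof.
apply: agree_eq => n; apply: agree_trans (@agree_W_pow _ _ _) _.
apply: (agree_trans _ (agree_sym (agreeM (@agree_W_pow _ _ _)
                                         (@agree_W_pow _ _ _)))).
rewrite -expgnDr val_Z2D; exact: agree_expg_mod.
Qed.

Lemma W_pow1 g : W_pow g 1%R = g.
Proof.
apply: agree_eq => n; apply: agree_trans (@agree_W_pow _ _ _) _.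
have -> : (1%R : Z2) n = (1 %% 2 ^ n.+1)%N :> nat.
  by rewrite -val_natZ2 -Z2_res_natr.
by rewrite -[X in agree _ _ X]expg1; exact: agree_expg_mod.
Qed.

Lemma W_pow0 g : W_pow g 0%R = 1.
Proof. by apply: (@mulgI _ (W_pow g 0%R)); rewrite -W_powD addr0 mulg1. Qed.

Lemma W_powN g z : W_pow g (- z)%R = (W_pow g z)^-1.
Proof.
by apply: (@mulgI _ (W_pow g z)); rewrite -W_powD subrr W_pow0 mulgV.
Qed.

Lemma agree_W_pow_cong g n y z :
  Z2_cong n.+1 y z -> agree n (W_pow g y) (W_pow g z).
Proof.
move=> yz; apply: agree_trans (@agree_W_pow _ _ _) _.
by rewrite yz//; apply: agree_sym; exact: agree_W_pow.
Qed.

End WPowers.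

(** * The characters and balanced automorphisms *)

Section Characters.
Local Open Scope ring_scope.
Variable p : nat.
Implicit Types (v w g h : W).

(** Here [k] counts the correct binary digits. The inner recursion lowers the index to 0, and
    passing from 0 back to [p] consumes one digit, which the factor 2 pays for. *)
Fixpoint chi_approx k : nat -> W -> Z2 :=
  if k isn't k'.+1 then fun _ _ => 0 else
  fix chik i w :=
    if i is i'.+1 then chik i' (sec w false) + chik i' (sec w true)
    else (flip w)%:R + chi_approx k' p (sec w false) *+ 2.

Lemma chi_approx_agree k i : exists n, forall v w, agree n v w ->
  chi_approx k i v = chi_approx k i w.
Proof.
elim: k i => [|k IH] i; first by exists 0%N.
elim: i => [|i [n IHi]]; last first.
  by exists n.+1 => v w vw /=; congr (_ + _); apply: IHi; exact: agree_sec.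
have [n IHp] := IH p; exists n.+1 => v w vw /=.
by rewrite (agree_flip vw) (IHp _ (sec w false))//; exact: agree_sec.
Qed.

Lemma chi_approxS k i w :
  Z2_cong k (chi_approx k.+1 i w) (chi_approx k i w).
Proof.
elim: k i w => [//|k IH]; elim=> [|i IHi] w.
  by apply: Z2_congD => //; apply: Z2_cong_double; exact: IH.
by apply: Z2_congD; exact: IHi.
Qed.

Definition chi i w : Z2 := sval (Z2_complete (fun k => @chi_approxS k i w)).

Lemma chi_cong_approx k i w : Z2_cong k (chi i w) (chi_approx k i w).
Proof. by rewrite /chi; case: Z2_complete. Qed.

Lemma chi0E w : chi 0 w = (flip w)%:R + chi p (sec w false) *+ 2.
Proof.
apply: Z2_cong_eq => k; apply: Z2_cong_leq (leqnSn k) _.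
apply: Z2_cong_trans (@chi_cong_approx _ _ _) _; apply: Z2_congD => //.
by apply: Z2_cong_double; apply: Z2_cong_sym; exact: chi_cong_approx.
Qed.

Lemma chiSE i w : chi i.+1 w = chi i (sec w false) + chi i (sec w true).
Proof.
apply: Z2_cong_eq => -[//|k]; apply: Z2_cong_trans (@chi_cong_approx _ _ _) _.
by apply: Z2_congD; apply: Z2_cong_sym; exact: chi_cong_approx.
Qed.

Lemma chi_agree i k : exists n, forall v w, agree n v w ->
  Z2_cong k (chi i v) (chi i w).
Proof.
have [n nP] := chi_approx_agree k i; exists n => v w vw.
apply: Z2_cong_trans (@chi_cong_approx _ _ _) _; rewrite (nP _ _ vw).
by apply: Z2_cong_sym; exact: chi_cong_approx.
Qed.

Lemma chi_limit i w x : (forall n, exists2 v, agree n v w & chi i v = x) ->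
  chi i w = x.
Proof.
move=> wx; apply: Z2_cong_eq => k; have [n nP] := chi_agree i k.
by have [v vw <-] := wx n; apply/nP/agree_sym.
Qed.

Definition balanced w : Prop :=
  chi p (sec w true) = chi p (sec w false) + (flip w)%:R.

(** A coinductive predicate in the form of a greatest fixed point: a witness is a set of balanced
    automorphisms stable under sections. *)
Definition balanced_all : set W :=
  [set w | exists2 S : set W, S w &
    forall v, S v -> balanced v /\ forall b, S (sec v b)].

Lemma balanced_allW w : balanced_all w -> balanced w.
Proof. by move=> [S Sw SP]; case: (SP _ Sw). Qed.

Lemma balanced_all_sec w b : balanced_all w -> balanced_all (sec w b).
Proof. by move=> [S Sw SP]; exists S => //; case: (SP _ Sw). Qed.

(** The recursion for [chi] never terminates, so identities are proved modulo [2^k], by induction on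
    [k] and then on the index. *)
Lemma chi1 i : chi i 1%g = 0.
Proof.
apply: Z2_cong_eq => k; elim: k i => [//|k IH]; elim=> [|i IHi].
  rewrite chi0E sec1 flip1 add0r -[X in Z2_cong _ _ X](mul0rn _ 2).
  exact: Z2_cong_double.
by rewrite chiSE !sec1 -[X in Z2_cong _ _ X]addr0; apply: Z2_congD.
Qed.

(** When [h] flips, the section of [g] at 1 occurs instead of that at 0. Balance turns its character
    into that at 0 plus [flip g], and twice this extra term is the carry in [flip g + flip h]. *)
Lemma chiM i g h : balanced_all g -> balanced_all h ->
  chi i (g * h)%g = chi i g + chi i h.
Proof.
move=> gb hb; apply: Z2_cong_eq => k.
elim: k i g h gb hb => [//|k IH]; elim=> [|i IHi] g h gb hb.
  rewrite !chi0E flipM secM addFb.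
  have := IH p _ _ (balanced_all_sec (flip h) gb) (balanced_all_sec false hb).
  move=> /Z2_cong_double gh.
  apply: (Z2_cong_trans (Z2_congD (@Z2_cong_refl _ _) gh)).
  suff -> : (flip g (+) flip h)%:R +
      (chi p (sec g (flip h)) + chi p (sec h false)) *+ 2 =
      (flip g)%:R + chi p (sec g false) *+ 2 +
      ((flip h)%:R + chi p (sec h false) *+ 2) :> Z2 by [].
  have := balanced_allW gb; rewrite /balanced.
  by case: (flip h) => [->|_]; case: (flip g) => /=; ring.
rewrite !chiSE !secM.
have cc b c := IHi _ _ (balanced_all_sec b gb) (balanced_all_sec c hb).
apply: (Z2_cong_trans (Z2_congD (cc _ _) (cc _ _))).
suff -> : forall b, chi i (sec g (false (+) b)) + chi i (sec h false) +
  (chi i (sec g (true (+) b)) + chi i (sec h true)) =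
  chi i (sec g false) + chi i (sec g true) +
  (chi i (sec h false) + chi i (sec h true)) by [].
by case=> /=; ring.
Qed.

Lemma balanced_all1 : balanced_all 1%g.
Proof.
exists [set 1%g] => // _ ->; split; last by move=> b; exact: sec1.
by rewrite /balanced !sec1 flip1 addr0.
Qed.

Lemma balanced_allM g h :
  balanced_all g -> balanced_all h -> balanced_all (g * h)%g.
Proof.
move=> gb hb.
exists [set x | exists y z,
    [/\ balanced_all y, balanced_all z & x = (y * z)%g]].
  by exists g, h.
move=> _ [y [z [yb zb ->]]]; split=> [|b]; last first.
  rewrite secM; exists (sec y (b (+) flip z)), (sec z b).
  by split=> //; exact: balanced_all_sec.
rewrite /balanced !secM flipM !chiM; try exact: balanced_all_sec.
have := balanced_allW yb; have := balanced_allW zb; rewrite /balanced => ->.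
by case: (flip z) => /= ->; case: (flip y) => /=; ring.
Qed.

Lemma chiV i g : balanced_all g -> chi i g^-1%g = - chi i g.
Proof.
move=> gb; apply: Z2_cong_eq => k.
elim: k i g gb => [//|k IH]; elim=> [|i IHi] g gb.
  rewrite !chi0E flipV secV addFb.
  have := IH p _ (balanced_all_sec (flip g) gb).
  move=> /Z2_cong_double gg.
  apply: (Z2_cong_trans (Z2_congD (@Z2_cong_refl _ _) gg)).
  suff -> : (flip g)%:R + (- chi p (sec g (flip g))) *+ 2 =
      - ((flip g)%:R + chi p (sec g false) *+ 2) :> Z2 by [].
  have := balanced_allW gb; rewrite /balanced.
  by case: (flip g) => [->|_] /=; ring.
rewrite !chiSE !secV.
have cc b := IHi _ (balanced_all_sec b gb).
apply: (Z2_cong_trans (Z2_congD (cc _) (cc _))).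
suff -> : forall b, - chi i (sec g (false (+) b)) - chi i (sec g (true (+) b)) =
  - (chi i (sec g false) + chi i (sec g true)) by [].
by case=> /=; ring.
Qed.

Lemma balanced_allV g : balanced_all g -> balanced_all g^-1%g.
Proof.
move=> gb; exists [set x | balanced_all x^-1%g]; first by rewrite /= invgK.
move=> x xb; split=> [|b] /=; last first.
  have := balanced_all_sec (b (+) flip x) xb.
  by rewrite secV addbK.
have := chiV p (balanced_all_sec false xb).
have := chiV p (balanced_all_sec true xb).
have := balanced_allW xb; rewrite /balanced !secV !invgK flipV => ->.
by case: (flip x) => /= -> ->; ring.
Qed.

Definition balanced_group : subgroup W :=
  Subgroup balanced_all1 balanced_allM balanced_allV.

(** The set of limits is stable under sections, and balance is an equation between continuous
    functions. *)
Lemma balanced_all_closed : closure balanced_all `<=` balanced_all.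
Proof.
move=> w /closureW wb.
exists [set w | forall n, exists2 v, balanced_all v & agree n v w] => //.
move=> {wb}w wb; split=> [|b n]; last first.
  have [v vb vw] := wb n.+1; exists (sec v b); last exact: agree_sec.
  exact: balanced_all_sec.
apply: Z2_cong_eq => k; have [n nP] := chi_agree p k.
have [v vb vw] := wb n.+1.
apply: (Z2_cong_trans (nP _ _ (agree_sec true (agree_sym vw)))).
rewrite (balanced_allW vb) (agree_flip vw); apply: Z2_congD => //.
exact/nP/agree_sec.
Qed.

(** For balanced [w], [flip w + 2 chi_p w_0] equals [chi_p w_0 + chi_p w_1], so the index 0 obeys
    the same rule as the others once indices are cyclic. *)
Lemma chi_pred (i : 'I_p.+1) w : balanced w ->
  chi i w = chi (ord_pred i) (sec w false) + chi (ord_pred i) (sec w true).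
Proof.
case: i => -[|i] lti /= bw; last first.
  by rewrite modnDr modn_small ?chiSE// ltnW.
by rewrite modn_small // chi0E bw; ring.
Qed.

End Characters.

(** * Closed subgroups and pairs of automorphisms *)

Arguments closed_gen : simpl never.

Section ClosedSubgroups.
Implicit Types (u v w : W) (H : subgroup W).

Lemma sub_closed_gen_limit (I : Type) (a : I -> W) w :
  (forall n, exists2 v, carrier (closed_gen a) v & agree n v w) ->
  carrier (closed_gen a) w.
Proof.
move=> wG; apply/closureW => n; have [v /closureW vG vw] := wG n.
by have [u uG uv] := vG n; exists u => //; exact: agree_trans uv vw.
Qed.

Lemma closed_gen_min (I : Type) (a : I -> W) H :
  closure H `<=` H -> (forall i, carrier H (a i)) -> closed_gen a `<=` H.
Proof.
move=> Hc Ha w; rewrite /= => /closureW wG; apply/Hc/closureW => n.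
by have [v vG vw] := wG n; exists v => //; apply: vG => _ [i _ <-]; exact: Ha.
Qed.

Lemma submgX (X : groupType) (H : subgroup X) x n :
  carrier H x -> carrier H (x ^+ n).
Proof.
move=> Hx; elim: n => [|n IH]; first exact: sub1g.
by rewrite expgS; exact: submg.
Qed.

Lemma closed_gen_W_pow (I : Type) (a : I -> W) g z :
  carrier (closed_gen a) g -> carrier (closed_gen a) (W_pow g z).
Proof.
move=> gG; apply: sub_closed_gen_limit => n.
exists (g ^+ (z n : nat)); first exact: submgX.
exact/agree_sym/agree_W_pow.
Qed.

Lemma mk_falseM u v u' v' :
  mk false u v * mk false u' v' = mk false (u * u') (v * v').
Proof. by apply: W_eq; rewrite ?flipM ?secM ?flip_mk ?sec_mk. Qed.

Lemma mk_false1 : mk false 1 1 = 1.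
Proof. by apply: W_eq; rewrite ?flip_mk ?sec_mk ?sec1. Qed.

Lemma mk_falseV u v : (mk false u v)^-1 = mk false u^-1 v^-1.
Proof.
by apply: (@mulgI _ (mk false u v)); rewrite mk_falseM !mulgV mk_false1.
Qed.

Lemma agree_mk n b u v u' v' : agree n u u' -> agree n v v' ->
  agree n.+1 (mk b u v) (mk b u' v').
Proof.
by move=> uu vv; apply: agree_cons => [|[]]; rewrite ?flip_mk ?sec_mk.
Qed.

End ClosedSubgroups.

(** * The group G *)

Section PeriodicGroup.
Variables (p : nat) (a : 'I_p.+1 -> W).
Hypothesis a_rec : periodic_recursion a.
Implicit Types (u v w g h : W) (i j : 'I_p.+1).
Local Notation G := (closed_gen a).
Local Notation chi := (chi p).
Local Notation balanced_all := (balanced_all p).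

Lemma genE i :
  a i = if i == ord0 then mk true 1 (a (ord_pred i))
        else mk false (a (ord_pred i)) 1.
Proof. by rewrite {1}a_rec -val_eqE. Qed.

Lemma flip_gen i : flip (a i) = (i == ord0).
Proof. by rewrite genE; case: ifP => _; rewrite flip_mk. Qed.

Lemma sec_gen i b :
  sec (a i) b = if b == (i == ord0) then a (ord_pred i) else 1.
Proof. by rewrite genE; case: ifP => _; rewrite sec_mk; case: b. Qed.

Lemma ord_pred_ord0 : ord_pred (@ord0 p) = ord_max.
Proof. by apply: ord_inj; rewrite /= modn_small. Qed.

Lemma val_ord_pred i : i != ord0 -> (ord_pred i).+1 = i :> nat.
Proof.
case: i => -[//|i] lti _ /=.
by rewrite modnDr modn_small// ltnW.
Qed.

Lemma chi_gen i j : chi i (a j) = ((i == j)%:R)%R.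
Proof.
(* The index becomes a natural number to allow induction on the precision [k] and then on [m]. *)
suff chi_gen_nat k m : (m < p.+1)%N -> forall i : 'I_p.+1,
    Z2_cong k (chi m (a i)) ((m == i)%:R)%R.
  by apply: Z2_cong_eq => k; exact: chi_gen_nat.
elim: k m => [//|k IH]; elim=> [|m IHm] ltm {}i.
  rewrite chi0E flip_gen sec_gen; case: (eqVneq i ord0) => [->|i0] /=.
    by rewrite chi1 mul0rn addr0.
  have := IH p (ltnSn p) (ord_pred i).
  rewrite gtn_eqF => [/Z2_cong_double|]; last first.
    by have := ltn_ord i; rewrite -(val_ord_pred i0).
  rewrite mul0rn add0r => h; rewrite ltn_eqF//.
  by rewrite lt0n; apply: contra i0.
have -> : chi m.+1 (a i) = chi m (a (ord_pred i)).
  by rewrite chiSE !sec_gen; case: (i == ord0); rewrite /= chi1 (add0r, addr0).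
have -> : (m.+1 == i) = (m == ord_pred i); last exact: (IHm (ltnW ltm)).
case: (eqVneq i ord0) => [->|i0]; last by rewrite -(val_ord_pred i0).
by rewrite ord_pred_ord0 /= (ltn_eqF (m := m)).
Qed.

Lemma balanced_gen i : balanced_all (a i).
Proof.
(* The generators together with 1 are stable under sections: they are the states of an automaton. *)
exists [set w | w = 1 \/ exists j, w = a j]; first by right; exists i.
move=> _ [->|[j ->]]; first split=> [|b].
- by rewrite /balanced !sec1 flip1 addr0.
- by left; rewrite sec1.
split=> [|b]; last by rewrite sec_gen; case: eqP => _; [right; eexists|left].
rewrite /balanced flip_gen !sec_gen; case: (eqVneq j ord0) => [->|j0] /=.
  by rewrite ord_pred_ord0 (chi_gen ord_max) eqxx chi1 add0r.
rewrite chi1 (chi_gen ord_max) addr0 -[ord_max == _]/(p == ord_pred j :> nat).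
rewrite gtn_eqF//.
by have := ltn_ord j; rewrite -(val_ord_pred j0).
Qed.

Lemma sub_balanced : G `<=` balanced_all.
Proof.
apply: (@closed_gen_min _ _ (balanced_group p)); last exact: balanced_gen.
exact: balanced_all_closed.
Qed.

(** The elements with both sections in [G] form a closed subgroup, and the sections of a generator
    are generators or 1. *)
Lemma closed_gen_sec w b : carrier G w -> carrier G (sec w b).
Proof.
have S1 : [set w | forall b, carrier G (sec w b)] 1.
  by move=> c; rewrite sec1; exact: (sub1g G).
have SM x y : [set w | forall b, carrier G (sec w b)] x ->
    [set w | forall b, carrier G (sec w b)] y ->
    [set w | forall b, carrier G (sec w b)] (x * y).
  by move=> Gx Gy c; rewrite secM; exact: (submg (s := G)).
have SV x : [set w | forall b, carrier G (sec w b)] x ->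
    [set w | forall b, carrier G (sec w b)] x^-1.
  by move=> Gx c; rewrite secV; exact: (subvg (s := G)).
move=> Gw; apply: (closed_gen_min (H := Subgroup S1 SM SV)) Gw b => [|i c] /=.
  move=> {}w /closureW Gw c; apply: sub_closed_gen_limit => n.
  have [v Gv vw] := Gw n.+1.
  by exists (sec v c); [exact: Gv|exact: agree_sec].
by rewrite sec_gen; case: eqP => _; [exact: mem_closed_gen|exact: (sub1g G)].
Qed.

Lemma gen_ordS i : i != ord_max -> a (ordS i) = mk false (a i) 1.
Proof.
move=> im; rewrite genE ifN ?ordSK// -val_eqE /= modn_small//.
have := ltn_ord i.
by rewrite ltnS leq_eqVlt -[_ == _]/(i == ord_max) (negPf im).
Qed.

Lemma gen0_sq : a ord0 * a ord0 = mk false (a ord_max) (a ord_max).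
Proof.
by apply: W_eq; rewrite ?flipM ?secM ?flip_mk ?sec_mk !flip_gen ?sec_gen //=
  ord_pred_ord0 ?mul1g ?mulg1.
Qed.

(** The pair [(a_p, a_p)] is the square of [a_0]. For [i < p] the pair [(a_i, a_i)] is [a_(i+1)]
    times its conjugate by [a_0], which moves the section to the other subtree. *)
Lemma closed_gen_diag g : carrier G g -> carrier G (mk false g g).
Proof.
have S1 : [set w | carrier G (mk false w w)] 1.
  by rewrite /= mk_false1; exact: (sub1g G).
have SM x y : [set w | carrier G (mk false w w)] x ->
    [set w | carrier G (mk false w w)] y ->
    [set w | carrier G (mk false w w)] (x * y).
  by move=> Gx Gy /=; rewrite -mk_falseM; exact: (submg (s := G)).
have SV x : [set w | carrier G (mk false w w)] x ->
    [set w | carrier G (mk false w w)] x^-1.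
  by move=> Gx /=; rewrite -mk_falseV; exact: (subvg (s := G)).
apply: (closed_gen_min (H := Subgroup S1 SM SV)) => [|i] /=.
  move=> w /closureW Gw; apply: sub_closed_gen_limit => n.
  have [v Gv vw] := Gw n; exists (mk false v v) => //.
  by apply: agree_leq (leqnSn n) _; exact: agree_mk.
have [->|im] := eqVneq i ord_max.
  by rewrite -gen0_sq; apply: (submg (s := G)); exact: mem_closed_gen.
have -> : mk false (a i) (a i) = a (ordS i) * lconj (a ord0) (a (ordS i)).
  rewrite gen_ordS// /lconj; apply: W_eq; rewrite !(flipM, secM, flipV, secV);
    rewrite ?flip_mk ?sec_mk ?flip_gen ?sec_gen //= ?ord_pred_ord0.
    by rewrite !mulg1 mulgV mulg1.
  by rewrite !mul1g invg1 mulg1.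
apply: (submg (s := G)); first exact: mem_closed_gen.
apply: (submg (s := G)); last by apply: (subvg (s := G)); exact: mem_closed_gen.
by apply: (submg (s := G)); exact: mem_closed_gen.
Qed.

(** The elements [w] with [(w, 1)] in [G] form a subgroup [L], stable under conjugation by [G]
    thanks to the diagonal elements, and containing every generator but [a_p]. So modulo [L] an
    element [g] of [G] is the power of [a_p] with exponent [chi_p g]. *)
Lemma closed_gen_left g : carrier G g -> (chi p g = 0)%R ->
  carrier G (mk false g 1).
Proof.
pose L := [set w | carrier G (mk false w 1)].
have L1 : L 1 by rewrite /L /= mk_false1; exact: (sub1g G).
have LM x y : L x -> L y -> L (x * y).
  move=> Lx Ly; rewrite /L /= -[X in mk _ _ X]mulg1 -mk_falseM.
  exact: (submg (s := G)).
have LV x : L x -> L x^-1.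
  move=> Lx; rewrite /L /= -[X in mk _ _ X]invg1 -mk_falseV.
  exact: (subvg (s := G)).
have LJ x y : carrier G x -> L y -> L (x * y * x^-1).
  move=> /closed_gen_diag Gx Ly; rewrite /L /=.
  rewrite (_ : mk _ _ _ = mk false x x * mk false y 1 * (mk false x x)^-1).
    apply: (submg (s := G)); last exact: (subvg (s := G)).
    exact: (submg (s := G)).
  by rewrite mk_falseV !mk_falseM mulg1 mulgV.
pose c z := W_pow (a ord_max) z.
have Gc z : carrier G (c z) by apply: closed_gen_W_pow; exact: mem_closed_gen.
(** [K] contains the generators, hence [G], and for [g] in the kernel of [chi p]
    membership in [K] is membership in [L]. *)
pose K := [set w | balanced_all w /\ L (w * c (- chi p w)%R)].
have K1 : K 1.
  split; first exact: balanced_all1.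
  by rewrite chi1 oppr0 /c W_pow0 mulg1.
have KM x y : K x -> K y -> K (x * y).
  move=> [xb Lx] [yb Ly]; split; first exact: balanced_allM.
  have := LM _ _ Lx (LJ _ _ (Gc (chi p x)) Ly).
  congr L; rewrite chiM// opprD addrC /c !W_powD !W_powN.
  by rewrite !mulgA mulgVK.
have KV x : K x -> K x^-1.
  move=> [xb Lx]; split; first exact: balanced_allV.
  have := LJ _ _ (Gc (- chi p x)%R) (LV _ Lx).
  by congr L; rewrite chiV// opprK /c !W_powN invgM !invgK !mulgA mulVg mul1g.
move=> Gg g0; suff [_] : K g by rewrite g0 oppr0 /c W_pow0 mulg1.
move: g {g0} Gg; apply: (closed_gen_min (H := Subgroup K1 KM KV)) => [|i].
  move=> w /closureW Kw; split.
    apply: balanced_all_closed; apply/closureW => n.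
    by have [v [vb _] vw] := Kw n; exists v.
  (* Level [m] fixes [chi p] modulo [2^(n+1)], which fixes the power of [a_p] at level [n]. *)
  apply: sub_closed_gen_limit => n; have [m mP] := chi_agree p p n.+1.
  have [v [_ Lv] vw] := Kw (maxn n m).
  exists (mk false (v * c (- chi p v)%R) 1) => //.
  apply: agree_leq (leqnSn n) _; apply: agree_mk => //.
  apply: agreeM; first exact: agree_leq (leq_maxl n m) vw.
  apply: agree_W_pow_cong; apply/Z2_congN/mP.
  exact: agree_leq (leq_maxr n m) vw.
split; first exact: balanced_gen.
rewrite (chi_gen ord_max); case: eqVneq => [<-|im].
  by rewrite /c W_powN W_pow1 mulgV.
rewrite oppr0 /c W_pow0 mulg1 /L /= -gen_ordS; first exact: mem_closed_gen.
by rewrite eq_sym.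
Qed.

(** A pair [(x, y)] with equal characters factors as [(x y^-1, 1) (y, y)]; the flipping case reduces
    to this one by splitting off [a_0] on the right. *)
Lemma closed_gen_mk (b : bool) u v : carrier G u -> carrier G v ->
  (chi p v = chi p u + b%:R)%R -> carrier G (mk b u v).
Proof.
have mkF x y : carrier G x -> carrier G y -> chi p y = chi p x ->
    carrier G (mk false x y).
  move=> Gx Gy xy.
  rewrite (_ : mk _ _ _ = mk false (x * y^-1) 1 * mk false y y).
    apply: (submg (s := G)); last exact: closed_gen_diag.
    apply: closed_gen_left.
      by apply: (submg (s := G)) => //; exact: (subvg (s := G)).
    by rewrite chiM ?chiV -?xy ?subrr//; do ?apply: balanced_allV;
      exact: sub_balanced.
  by rewrite mk_falseM mulgVK mul1g.
move=> Gu Gv uv; case: b uv => uv; last by apply: mkF; rewrite // uv addr0.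
have Ga i : carrier G (a i) by exact: mem_closed_gen.
rewrite (_ : mk _ _ _ = mk false (v * (a ord_max)^-1) u * a ord0); last first.
  by apply: W_eq; rewrite !(flip_mk, sec_mk, flip_gen, sec_gen, flipM, secM) /=
    ?ord_pred_ord0 ?mulgVK ?mulg1.
apply: (submg (s := G)) => //; apply: mkF => //.
  by apply: (submg (s := G)) => //; exact: (subvg (s := G)).
have [? ? ?] : [/\ balanced_all v, balanced_all (a ord_max) &
  balanced_all (a ord_max)^-1].
  by split; [|exact: balanced_gen|apply: balanced_allV]; apply: sub_balanced.
by rewrite chiM// chiV// (chi_gen ord_max) eqxx uv addrK.
Qed.

End PeriodicGroup.

(** * Automorphisms that conjugate G into itself *)

Section Conjugators.
Variables (p : nat) (a : 'I_p.+1 -> W).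
Hypothesis a_rec : periodic_recursion a.
Implicit Types (u v w g h : W) (i j : 'I_p.+1) (k : 'I_p.+1 -> Z2).
Local Notation G := (closed_gen a).
Local Notation chi := (chi p).
Local Notation balanced_all := (balanced_all p).

Lemma chi_W_pow (m : nat) g z : balanced_all g ->
  chi m (W_pow g z) = (chi m g * z)%R.
Proof.
move=> gb; apply: Z2_cong_eq => l; have [n nP] := chi_agree p m l.
pose N := maxn n l.
apply: (Z2_cong_trans (nP _ (g ^+ (z N : nat)) _)).
  exact: agree_leq (leq_maxl n l) (@agree_W_pow _ _ _).
have -> : chi m (g ^+ (z N : nat)) = (chi m g * (z N : nat)%:R)%R.
  elim: (z N : nat) => [|q IH]; first by rewrite expg0 chi1 mulr0.
  have qb : balanced_all (g ^+ q).
    exact: (@submgX _ (balanced_group p)).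
  by rewrite expgS chiM// IH -mulr_natr; ring.
apply: Z2_congM => //; apply: Z2_cong_sym.
by apply: (Z2_cong_leq _ (@Z2_cong_natr z N)); rewrite ltnW// ltnS leq_maxr.
Qed.

Lemma flip_lconj w g : flip (lconj w g) = flip g.
Proof. by rewrite /lconj !flipM flipV addbC addKb. Qed.

(** Indexing by the image letter [b (+) flip w] makes the right-hand side free of [flip w]. *)
Lemma sec_lconj w g b : sec (lconj w g) (b (+) flip w) =
  sec w (b (+) flip g) * sec g b * (sec w b)^-1.
Proof. by rewrite /lconj !secM secV flipV !addbK. Qed.

Lemma agree_lconj n w w' g g' : agree n w w' -> agree n g g' ->
  agree n (lconj w g) (lconj w' g').
Proof. by move=> ww gg; apply: agreeM; [exact: agreeM|exact: agreeV]. Qed.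

(** Only one inclusion, tested on generators: this form passes to sections easily. Equality is
    recovered in [conjugator_normalizer]. *)
Definition conjugator w : Prop := forall i, carrier G (lconj w (a i)).

(** The diagonal entry of the matrix of [w] on the abelianization. *)
Definition multiplier w i : Z2 := chi i (lconj w (a i)).

(** The two sections of [w a_0 w^-1] are [w_1 w_0^-1], treated here, and [w_0 a_p w_1^-1], treated
    next. *)
Lemma conjugator_quot w : conjugator w ->
  carrier G (sec w true * (sec w false)^-1).
Proof.
move=> /(_ ord0) /(closed_gen_sec a_rec (b := false (+) flip w)).
by rewrite sec_lconj flip_gen// sec_gen// mulg1.
Qed.

Lemma conjugator_quot0 w : conjugator w ->
  carrier G (sec w false * a ord_max * (sec w true)^-1).
Proof.
move=> /(_ ord0) /(closed_gen_sec a_rec (b := true (+) flip w)).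
by rewrite sec_lconj flip_gen// sec_gen//= ord_pred_ord0.
Qed.

Lemma conjugator_quotM w : sec w false * a ord_max * (sec w true)^-1 *
  (sec w true * (sec w false)^-1) = lconj (sec w false) (a ord_max).
Proof. by rewrite !mulgA mulgVK. Qed.

(** For [i < p] the conjugate is a section of [w a_(i+1) w^-1]; for [i = p] it is the product of the
    two sections of [w a_0 w^-1]. *)
Lemma conjugator_sec w : conjugator w -> conjugator (sec w false).
Proof.
move=> wM i; have [->|im] := eqVneq i ord_max.
  rewrite -conjugator_quotM; apply: (submg (s := G)).
    exact: conjugator_quot0.
  exact: conjugator_quot.
have := closed_gen_sec a_rec (b := false (+) flip w) (wM (ordS i)).
rewrite sec_lconj (gen_ordS a_rec im) flip_mk !sec_mk.
by [].
Qed.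

Lemma chi_lconj_sec w i j : conjugator w ->
  chi i (lconj w (a j)) =
  chi (ord_pred i) (lconj (sec w false) (a (ord_pred j))).
Proof.
move=> wM; have wb := sub_balanced a_rec (wM j).
rewrite (chi_pred _ (balanced_allW wb)).
(* The flip of [w] permutes the letters, which leaves the sum over both sections unchanged. *)
have -> : (chi (ord_pred i) (sec (lconj w (a j)) false) +
    chi (ord_pred i) (sec (lconj w (a j)) true))%R =
  (chi (ord_pred i) (sec (lconj w (a j)) (false (+) flip w)) +
    chi (ord_pred i) (sec (lconj w (a j)) (true (+) flip w)))%R.
  by case: (flip w) => //=; rewrite addrC.
rewrite !sec_lconj !flip_gen// !sec_gen//.
have [->|j0] /= := eqVneq j ord0; last by rewrite mulg1 mulgV chi1 addr0.
rewrite mulg1 ord_pred_ord0 addrC -chiM; last 2 first.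
- exact: (sub_balanced a_rec (conjugator_quot0 wM)).
- exact: (sub_balanced a_rec (conjugator_quot wM)).
by rewrite conjugator_quotM.
Qed.

Lemma multiplier_sec w i : conjugator w ->
  multiplier w i = multiplier (sec w false) (ord_pred i).
Proof. exact: chi_lconj_sec. Qed.

Lemma chi_lconj_offdiag w i j : conjugator w -> i != j ->
  chi i (lconj w (a j)) = 0%R.
Proof.
(* Passing to [w_0] lowers both indices cyclically until the row index is 0. *)
have [m] := ubnP (i : nat); elim: m w i j => // m IH w i j im wM ij.
have wM' := conjugator_sec wM.
rewrite chi_lconj_sec//.
have [i0|i0] := eqVneq i ord0; last first.
  apply: IH => //; last by rewrite (can_eq (@ord_predK _)).
  by rewrite val_ord_pred.
move: ij; rewrite i0 eq_sym => j0; rewrite ord_pred_ord0.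
(* As [w a_j w^-1] does not flip, balance equates [chi_p] on its two sections, one of which is
   trivial. *)
have := balanced_allW (sub_balanced a_rec (wM j)).
rewrite /balanced flip_lconj flip_gen// (negPf j0) addr0.
have := sec_lconj w (a j) false; have := sec_lconj w (a j) true.
rewrite !flip_gen// !sec_gen// (negPf j0) /= mulg1 mulgV.
by case: (flip w) => /= -> ->; rewrite chi1.
Qed.

(** On generators the formula is the vanishing off the diagonal; it extends to [G] by additivity and
    continuity. *)
Lemma closed_gen_lconj w g : conjugator w -> carrier G g ->
  carrier G (lconj w g) /\
  forall i, chi i (lconj w g) = (multiplier w i * chi i g)%R.
Proof.
move=> wM; pose S := [set g | [/\ carrier G g, carrier G (lconj w g) &
  forall i, chi i (lconj w g) = (multiplier w i * chi i g)%R]].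
have Gb x : carrier G x -> balanced_all x by exact: (sub_balanced a_rec).
have S1 : S 1.
  split; [exact: (sub1g G)|by rewrite lconj_one; exact: (sub1g G)|move=> i].
  by rewrite lconj_one chi1 mulr0.
have SM x y : S x -> S y -> S (x * y).
  move=> [Gx Gwx xS] [Gy Gwy yS]; split; first exact: (submg (s := G)).
    by rewrite lconj_mul; exact: (submg (s := G)).
  move=> i; rewrite lconj_mul (chiM _ (Gb _ Gwx) (Gb _ Gwy)).
  by rewrite (chiM _ (Gb _ Gx) (Gb _ Gy)) xS yS mulrDr.
have SV x : S x -> S x^-1.
  move=> [Gx Gwx xS]; split; first exact: (subvg (s := G)).
    by rewrite lconj_inv; exact: (subvg (s := G)).
  move=> i; rewrite lconj_inv (chiV _ (Gb _ Gwx)).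
  by rewrite (chiV _ (Gb _ Gx)) xS mulrN.
move=> Gg; suff [] : S g by [].
move: g Gg; apply: (closed_gen_min (H := Subgroup S1 SM SV)) => [|i];
    last first.
  split; [exact: mem_closed_gen|exact: wM|move=> j].
  rewrite chi_gen//; have [->|ji] := eqVneq j i; first by rewrite mulr1.
  by rewrite mulr0; exact: chi_lconj_offdiag.
move=> g /closureW Sg; split.
- by apply: sub_closed_gen_limit => n; have [v []] := Sg n; exists v.
- apply: sub_closed_gen_limit => n; have [v [_ Gv _] vg] := Sg n.
  by exists (lconj w v) => //; exact: agree_lconj.
move=> i; apply: Z2_cong_eq => m; have [n nP] := chi_agree p i m.
have [v [_ _ vS] vg] := Sg n.
apply: (@Z2_cong_trans _ _ (chi i (lconj w v))).
  by apply: nP; apply: agree_lconj => //; exact: agree_sym.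
by rewrite vS; apply: Z2_congM => //; exact: nP.
Qed.

Lemma conjugatorM u v : conjugator u -> conjugator v -> conjugator (u * v).
Proof.
move=> uM vM i; rewrite lconjM.
by case: (closed_gen_lconj uM (vM i)).
Qed.

Lemma multiplierM u v i : conjugator u -> conjugator v ->
  multiplier (u * v) i = (multiplier u i * multiplier v i)%R.
Proof.
move=> uM vM; rewrite /multiplier lconjM.
by case: (closed_gen_lconj uM (vM i)) => _ ->.
Qed.

Lemma closed_gen_conjugator g : carrier G g -> conjugator g.
Proof.
move=> Gg i; apply: (submg (s := G)); last exact: (subvg (s := G)).
by apply: (submg (s := G)) => //; exact: mem_closed_gen.
Qed.

Lemma closed_gen_multiplier g i : carrier G g -> multiplier g i = 1%R.
Proof.
move=> /(sub_balanced a_rec) gb; have ab := balanced_gen a_rec i.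
rewrite /multiplier /lconj chiM//; [|exact: balanced_allM|exact: balanced_allV].
by rewrite chiM// chiV// addrC addKr chi_gen// eqxx.
Qed.

(** The characters of the two sections of [w a_0 w^-1] add up to the multiplier, and by balance they
    differ by 1, in an order that depends on [flip w]. *)
Lemma chi_conjugator_quot w : conjugator w ->
  (chi p (sec w true * (sec w false)^-1)%g *+ 2 + 1 =
   multiplier w ord0 + (flip w)%:R *+ 2)%R.
Proof.
move=> wM; have := sub_balanced a_rec (conjugator_quot0 wM).
have := sub_balanced a_rec (conjugator_quot wM) => qb qb0.
rewrite multiplier_sec// /multiplier ord_pred_ord0 -conjugator_quotM.
rewrite (chiM _ qb0 qb).
have := balanced_allW (sub_balanced a_rec (wM ord0)).
rewrite /balanced flip_lconj flip_gen// eqxx.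
have := sec_lconj w (a ord0) false; have := sec_lconj w (a ord0) true.
rewrite !flip_gen// !sec_gen// !eqxx /= mulg1 ord_pred_ord0.
by case: (flip w) => /= -> -> ->; ring.
Qed.

Lemma multiplier1_closed_gen w : conjugator w ->
  (forall i, multiplier w i = 1%R) -> carrier G w.
Proof.
move=> wM w1; apply: sub_closed_gen_limit => n.
elim: n w wM w1 => [|n IH] w wM w1.
  by exists 1; [exact: (sub1g G)|exact: agree0].
have wM' := conjugator_sec wM.
have [|u Gu uw] := IH _ wM'.
  by move=> i; rewrite -[i](@ordSK _) -multiplier_sec.
have Gq := conjugator_quot wM; set q := _ * _ in Gq.
(* Since [w_1 = q w_0], an approximation [u] of [w_0] gives the approximation [q u] of [w_1], and
   the character of [q] makes the result balanced. *)
exists (mk (flip w) u (q * u)).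
  apply: closed_gen_mk => //; first exact: (submg (s := G)).
  have qE : chi p q = ((flip w)%:R)%R.
    apply: Z2_double_inj; apply: (addIr 1%R).
    by rewrite chi_conjugator_quot// w1 addrC.
  by rewrite chiM ?qE 1?addrC//; exact: (sub_balanced a_rec).
rewrite [X in agree _ _ X]W_eta; apply: agree_mk => //.
rewrite -[X in agree _ _ X](mulgVK (sec w false)).
exact: agreeM.
Qed.

(** For odd [k_0] the exponent is [(k_0 - 1)/2], the character that [chi_conjugator_quot] imposes on
    the quotient of the two sections. The shift of [k] reflects [multiplier_sec]. *)
Fixpoint scaling_approx n (k : 'I_p.+1 -> Z2) : W :=
  if n isn't m.+1 then 1 else
  let u := scaling_approx m (k \o @ordS _) in
  mk false u (W_pow (a ord_max) (Z2_half (k ord0)) * u).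

Lemma scaling_approxS n k :
  agree n (scaling_approx n.+1 k) (scaling_approx n k).
Proof.
elim: n k => [|n IH] k; first exact: agree0.
by apply: agree_mk; [exact: IH|apply: agreeM => //; exact: IH].
Qed.

(** An element of the normalizer that acts on the abelianization as the diagonal
    matrix [k], provided that all the [k i] are odd. *)
Definition scaling k : W :=
  sval (W_complete (fun n => @scaling_approxS n k)).

Lemma agree_scaling n k : agree n (scaling k) (scaling_approx n k).
Proof. by rewrite /scaling; case: W_complete. Qed.

Lemma scalingE k (u := scaling (k \o @ordS _)) :
  scaling k = mk false u (W_pow (a ord_max) (Z2_half (k ord0)) * u).
Proof.
apply: agree_eq => n; apply: agree_leq (leqnSn n) _.
apply: agree_trans (@agree_scaling _ _) _.
by apply: agree_mk; [|apply: agreeM => //]; exact/agree_sym/agree_scaling.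
Qed.

Lemma agree_scaling_cong n k k' : (forall i, Z2_cong n.+1 (k i) (k' i)) ->
  agree n (scaling k) (scaling k').
Proof.
elim: n k k' => [|n IH] k k' kk; first exact: agree0.
have uu : agree n (scaling (k \o @ordS _)) (scaling (k' \o @ordS _)).
  by apply: IH => i /=; exact: Z2_cong_leq (kk _).
rewrite scalingE [X in agree _ _ X]scalingE; apply: agree_mk => //.
apply: agreeM => //; apply: agree_W_pow_cong.
exact/Z2_cong_half/kk.
Qed.

(** Membership of the conjugate in [G] is not yet known, so it is approximated level by level. The
    coordinates of the approximations are exact, because the next level needs them to verify
    balance. *)
Lemma scaling_lconj_approx n (k : 'I_p.+1 -> Z2) j :
  (forall i, odd (k i 0%N)) ->
  exists2 g, carrier G g /\ (forall i, chi i g = k j * (i == j)%:R)%R &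
    agree n g (lconj (scaling k) (a j)).
Proof.
elim: n k j => [|n IH] k j kodd.
  exists (W_pow (a j) (k j)); last exact: agree0.
  split=> [|i]; first by apply: closed_gen_W_pow; exact: mem_closed_gen.
  by rewrite chi_W_pow ?chi_gen 1?mulrC//; exact: balanced_gen.
set u := scaling (k \o @ordS _); set c := W_pow (a ord_max) (Z2_half (k ord0)).
have Gc : carrier G c by apply: closed_gen_W_pow; exact: mem_closed_gen.
have cb := sub_balanced a_rec Gc; have cVb := balanced_allV cb.
have chic i : chi i c = ((i == ord_max)%:R * Z2_half (k ord0))%R.
  by rewrite chi_W_pow ?chi_gen//; exact: balanced_gen.
have [|g [Gg gk] gu] := IH (k \o @ordS _) (ord_pred j); first by move=> i /=.
have gb := sub_balanced a_rec Gg.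
have {}gk i : chi (ord_pred i) g = (k j * (i == j)%:R)%R.
  by rewrite gk /= ord_predK (can_eq (@ord_predK _)).
have gp : chi p g = (k j * (ord0 == j)%:R)%R by rewrite -gk ord_pred_ord0.
have [j0|j0] := eqVneq j ord0; last first.
  have Gg1 : carrier G (mk false g 1).
    apply: closed_gen_left => //.
    by rewrite gp eq_sym (negPf j0) mulr0.
  exists (mk false g 1).
    split=> // i; rewrite (chi_pred _ (balanced_allW (sub_balanced a_rec Gg1))).
    by rewrite !sec_mk chi1 addr0 gk.
  have -> : lconj (scaling k) (a j) = mk false (lconj u (a (ord_pred j))) 1.
    rewrite scalingE -/u -/c genE// (negPf j0) /lconj; apply: W_eq;
      rewrite !(flip_mk, sec_mk, flipM, secM, flipV, secV) //=.
    by rewrite mulg1 mulgV.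
  exact: agree_mk.
rewrite j0 in gp gk gu *.
have k0E := Z2_halfK (k ord0); rewrite kodd /= in k0E.
have gcG : carrier G (g * c^-1).
  by apply: (submg (s := G)) => //; exact: (subvg (s := G)).
have gcb := sub_balanced a_rec gcG.
(* With [h = (k_0 - 1)/2] the sections have characters [h] and [k_0 - h = h + 1], as balance
   requires. *)
have Gm : carrier G (mk true c (g * c^-1)).
  apply: closed_gen_mk => //.
  rewrite chiM// chiV// (chic ord_max) gp.
  by rewrite !eqxx [X in (X * _)%R]k0E; ring.
exists (mk true c (g * c^-1)).
  split=> // i; rewrite (chi_pred _ (balanced_allW (sub_balanced a_rec Gm))).
  by rewrite !sec_mk /= chiM// chiV// gk; ring.
have -> : lconj (scaling k) (a ord0) =
    mk true c (lconj u (a (ord_pred ord0)) * c^-1).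
  rewrite scalingE -/u -/c genE// eqxx /lconj; apply: W_eq;
    rewrite !(flip_mk, sec_mk, flipM, secM, flipV, secV) //=.
    by rewrite mulg1 mulgK.
  by rewrite invgM mulgA.
by apply: agree_mk => //; exact: agreeM.
Qed.

Lemma conjugator_scaling (k : 'I_p.+1 -> Z2) : (forall i, odd (k i 0%N)) ->
  conjugator (scaling k).
Proof.
move=> kodd i; apply: sub_closed_gen_limit => n.
by have [g [Gg _] gk] := scaling_lconj_approx n i kodd; exists g.
Qed.

Lemma multiplier_scaling (k : 'I_p.+1 -> Z2) i : (forall i, odd (k i 0%N)) ->
  multiplier (scaling k) i = k i.
Proof.
move=> kodd; apply: chi_limit => n.
have [g [_ gk] gn] := scaling_lconj_approx n i kodd.
by exists g; rewrite // gk eqxx mulr1.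
Qed.

End Conjugators.

(** * Continuity of maps into and out of products *)

Lemma ffun_continuous (Y : topologicalType) (I : finType) (T : topologicalType)
    (f : Y -> {ffun I -> T}) :
  (forall i, continuous (fun y => f y i)) -> continuous f.
Proof.
move=> fc; apply: (@continuous_comp_initial {ffun I -> T} Y
  (prod_topology (fun _ : I => T)) (fun g : {ffun I -> T} => (g : I -> T))).
move=> y; apply/cvg_sup => i.
move=> U [? /= [[V oV <-]] /= Vfy] /filterS; apply; apply: fc.
exact: open_nbhs_nbhs.
Qed.

Lemma ffun_eval_continuous (I : finType) (T : topologicalType) (i : I) :
  continuous (fun g : {ffun I -> T} => g i).
Proof.
move=> g; apply: (@continuous_comp _ _ _ 
  (fun g : {ffun I -> T} => (g : prod_topology (fun _ : I => T))) (proj i)).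
  exact: (@initial_continuous {ffun I -> T} (prod_topology (fun _ : I => T)) _).
exact: proj_continuous.
Qed.

Lemma ffun_W_continuous (I : finType) (T : topologicalType) (v : T -> Z2)
    (F : (I -> Z2) -> W) : continuous v ->
  (forall n, exists m, forall x y, (forall i, Z2_cong m (x i) (y i)) ->
    agree n (F x) (F y)) ->
  continuous (fun g : {ffun I -> T} => F (fun i => v (g i))).
Proof.
move=> vc Fc g A [n _ nA]; have [m mF] := Fc n.
have : nbhs g [set h : {ffun I -> T} | forall i, Z2_cong m (v (h i)) (v (g i))].
  apply: (@filter_forall _ _
    (fun i (h : {ffun I -> T}) => Z2_cong m (v (h i)) (v (g i))) (nbhs g)) => i.
  have vg : nbhs (g i) [set t | Z2_cong m (v t) (v (g i))].
    apply: (vc (g i) [set z | Z2_cong m z (v (g i))]).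
    by apply/nbhs_Z2; exists m.
  exact: (ffun_eval_continuous vg).
by apply: filterS => h hg; apply: nA => t tn; exact: (mF _ _ hg).
Qed.

Lemma Z2_continuous (T : topologicalType) (f : T -> Z2) :
  (forall x n, \forall y \near x, Z2_cong n (f y) (f x)) -> continuous f.
Proof.
move=> fc x A /nbhs_Z2[n nA]; have := fc x n.
by apply: filterS => y; exact: nA.
Qed.

Lemma chi_continuous p i : continuous (chi p i).
Proof.
apply: Z2_continuous => w n; have [m mP] := chi_agree p i n.
by exists m => // v /= vw; exact: mP.
Qed.

Lemma mulg_fun_continuous (Y : topologicalType) (X : topGroupType)
    (f g : Y -> X) :
  continuous f -> continuous g -> continuous (fun y => f y * g y).
Proof.
move=> fc gc y; apply: (@continuous_comp _ _ _ (fun y => (f y, g y))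
  (fun xy : X * X => xy.1 * xy.2)); last exact: mulg_continuous.
exact: cvg_pair (fc y) (gc y).
Qed.

(** * The abelianization of G *)

Section Abelianization.
Variables (p : nat) (a : 'I_p.+1 -> W).
Hypothesis a_rec : periodic_recursion a.
Implicit Types (i j : 'I_p.+1) (g h : [grp closed_gen a]).
Implicit Types (x y : {ffun 'I_p.+1 -> Z2}).
Local Notation G := (closed_gen a).
Local Notation chi := (chi p).

Lemma grp_balanced g : balanced_all p (subgroup_val g).
Proof. exact: (sub_balanced a_rec (subgroup_valP g)). Qed.

Definition coords g : {ffun 'I_p.+1 -> Z2} :=
  [ffun i : 'I_p.+1 => chi i (subgroup_val g)].

Lemma coordsM g h : coords (g * h) = (coords g + coords h)%R.
Proof.
apply/ffunP => i; rewrite !ffunE /= subgroup_valM chiM//;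
  exact: grp_balanced.
Qed.

Lemma coordsV g : coords g^-1 = (- coords g)%R.
Proof.
apply/ffunP => i; rewrite !ffunE /= subgroup_valV chiV//;
  exact: grp_balanced.
Qed.

Lemma coords1 : coords 1 = 0%R.
Proof. by apply/ffunP => i; rewrite !ffunE chi1. Qed.

Lemma coords_gen i : coords (closed_gen_elt a i) = Z2_basis i.
Proof. by apply/ffunP => j; rewrite !ffunE; exact: chi_gen. Qed.

Lemma coords_continuous : continuous coords.
Proof.
apply: ffun_continuous => i.
rewrite (_ : (fun _ => _) = chi i \o @subgroup_val _ G); last first.
  by apply/funext => g; rewrite ffunE.
move=> g; apply: continuous_comp; first exact: subgroup_val_continuous.
exact: chi_continuous.
Qed.

(** The image of [P] in [W] is a subgroup containing the generators, so it comes arbitrarily close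
    to every element of [G]. *)
Lemma closed_grp_min (P : subgroup [grp G]) : closure P `<=` P ->
  (forall i, carrier P (closed_gen_elt a i)) -> forall g, carrier P g.
Proof.
move=> Pc Pa g; apply: Pc => B /= [_ [[V oV <-] /= Vg VB]].
pose Q := [set w | exists2 h, carrier P h & subgroup_val h = w].
have Q1 : Q 1 by exists 1; first exact: sub1g.
have QM u v : Q u -> Q v -> Q (u * v).
  by move=> [h Ph <-] [k Pk <-]; exists (h * k); first exact: submg.
have QV u : Q u -> Q u^-1 by move=> [h Ph <-]; exists h^-1; first exact: subvg.
have [w [Gw Vw]] := subgroup_valP g V (open_nbhs_nbhs (conj oV Vg)).
have [|h Ph hw] := Gw (Subgroup Q1 QM QV).
  by move=> _ [i _ <-]; exists (closed_gen_elt a i).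
exists h; split => //; apply: VB.
by rewrite /= -[set_val h]/(subgroup_val h) hw.
Qed.

Lemma ab_projP g h : ab_proj g = ab_proj h <->
  carrier (closed_derived [grp G]) (g^-1 * h).
Proof. exact: qprojP. Qed.

Lemma ab_proj_eq_coords g h : ab_proj g = ab_proj h -> coords g = coords h.
Proof.
move=> /ab_projP gh.
suff: coords (g^-1 * h) = 0%R.
  by rewrite coordsM coordsV addrC => /eqP; rewrite subr_eq0 => /eqP.
move: gh; set z := _ * h => zD; apply/ffunP => i.
rewrite !ffunE; apply: Z2_cong_eq => k.
have [n nP] := chi_agree p i k.
have nz : nbhs (subgroup_val z) [set w | agree n w (subgroup_val z)].
  by exists n.
(* While [z] is only a limit of products of commutators, [u] is such a product, with character
   congruent to that of [z] modulo [2^k]. *)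
have [u [Du uz]] := zD _ (subgroup_val_continuous nz).
apply: (Z2_cong_trans (Z2_cong_sym (nP _ _ uz))).
suff -> : chi i (subgroup_val u) = 0%R by [].
pose K := [set u : [grp G] | coords u = 0%R].
have K1 : K 1 by exact: coords1.
have KM s t : K s -> K t -> K (s * t).
  by rewrite /K /= coordsM => -> ->; rewrite addr0.
have KV s : K s -> K s^-1 by rewrite /K /= coordsV => ->; rewrite oppr0.
have /(congr1 (fun f : {ffun _} => f i)) : K u; last by rewrite !ffunE.
apply: (Du (Subgroup K1 KM KV)) => _ [s [t ->]].
rewrite /K /= /commg /conjg !coordsM !coordsV.
by rewrite [(coords s + _)%R]addrC addKr addNr.
Qed.

Definition powg i (z : Z2) : [grp G] :=
  subgroup_in (@closed_gen_W_pow _ a (a i) z (@mem_closed_gen _ a i)).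

(** A continuous right inverse of [coords], which becomes additive after projection to the
    abelianization. *)
Definition prodg x : [grp G] := \prod_(i < p.+1) powg i (x i).

Lemma val_prodg x :
  subgroup_val (prodg x) = \prod_(i < p.+1) W_pow (a i) (x i).
Proof. exact: (big_morph _ (@subgroup_valM _ G)). Qed.

Lemma prodg_continuous : continuous prodg.
Proof.
apply: continuous_subgroup.
rewrite (_ : _ \o _ = fun x => \prod_(i < p.+1) W_pow (a i) (idfun (x i)));
  last by apply/funext => x /=; exact: val_prodg.
pose F (x : 'I_p.+1 -> Z2) := \prod_(i < p.+1) W_pow (a i) (x i).
apply: (@ffun_W_continuous _ _ idfun F) => [z|n]; first exact: cvg_id.
exists n.+1 => x y xy; rewrite /F.
apply: (big_ind2 (fun u v => agree n u v)) => // [u u' v v'|i _].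
  exact: agreeM.
exact/agree_W_pow_cong.
Qed.

Definition from_coords x : abelianization [grp G] := ab_proj (prodg x).

Lemma ab_proj1 : ab_proj (1 : [grp G]) = 1.
Proof.
by apply: (@mulgI _ (@ab_proj [grp G] 1)); rewrite -ab_projM !mulg1.
Qed.

Lemma ab_projV g : ab_proj g^-1 = (ab_proj g)^-1.
Proof.
by apply: (@mulgI _ (ab_proj g)); rewrite -ab_projM !mulgV ab_proj1.
Qed.

Lemma ab_commute (u v : abelianization [grp G]) : commute u v.
Proof.
have [g <-] := ab_surj u; have [h <-] := ab_surj v.
rewrite /commute -!ab_projM; apply/ab_projP/subset_closure.
have -> : (g * h)^-1 * (h * g) = [~ h, g].
  by rewrite /commg /conjg invgM !mulgA.
by move=> H; apply; exists h, g.
Qed.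

Lemma from_coordsE x : from_coords x = \prod_(i < p.+1) ab_proj (powg i (x i)).
Proof. exact: (big_morph _ (@ab_projM [grp G]) ab_proj1). Qed.

Lemma from_coordsD : {morph from_coords : x y / (x + y)%R >-> x * y}.
Proof.
move=> x y; rewrite !from_coordsE -prodgM_commute => [|i j _ _];
  last exact: ab_commute.
apply: eq_bigr => i _; rewrite -ab_projM; congr ab_proj.
by apply: subgroup_val_inj; rewrite ffunE; exact: W_powD.
Qed.

Lemma from_coords_basis i :
  from_coords (Z2_basis i) = ab_proj (closed_gen_elt a i).
Proof.
congr ab_proj; apply: subgroup_val_inj; rewrite val_prodg.
rewrite (@big_only1 _ _ _ _ i) // => [|j ji _].
  by rewrite ffunE eqxx; exact: W_pow1.
by rewrite ffunE (negPf ji); exact: W_pow0.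
Qed.

Lemma from_coords0 : from_coords 0%R = 1.
Proof.
by apply: (@mulgI _ (from_coords 0%R)); rewrite -from_coordsD addr0 mulg1.
Qed.

Lemma from_coordsN x : from_coords (- x)%R = (from_coords x)^-1.
Proof.
apply: (@mulgI _ (from_coords x)).
by rewrite -from_coordsD subrr from_coords0 mulgV.
Qed.

Lemma coordsK g : from_coords (coords g) = ab_proj g.
Proof.
pose P := [set h | from_coords (coords h) = ab_proj h].
have P1 : P 1 by rewrite /P /= coords1 from_coords0 ab_proj1.
have PM u v : P u -> P v -> P (u * v).
  by rewrite /P /= coordsM from_coordsD ab_projM => -> ->.
have PV u : P u -> P u^-1 by rewrite /P /= coordsV from_coordsN ab_projV => ->.
apply: (@closed_grp_min (Subgroup P1 PM PV)) => [|i] /=; last first.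
  by rewrite /P /= coords_gen from_coords_basis.
(* Closedness is checked in [G] itself: the equation says that a continuous function of [h] lies in
   the closed derived subgroup. *)
have -> : P = (fun h => (prodg (coords h))^-1 * h) @^-1`
    carrier (closed_derived [grp G]).
  by apply/seteqP; split => h /ab_projP.
pose f h := (prodg (coords h))^-1 * h.
suff fc : continuous f.
  have /closure_id <- // : closed (f @^-1` carrier (closed_derived [grp G])).
  apply: ((@continuous_closedP [grp G] [grp G] f).1 fc).
  exact: (@closed_closure [grp G]).
apply: mulg_fun_continuous => h; last exact: cvg_id.
apply: continuous_comp; last exact: invg_continuous.
apply: continuous_comp; first exact: coords_continuous.
exact: prodg_continuous.
Qed.

Lemma prodgK x : coords (prodg x) = x.
Proof.
apply/ffunP => i; rewrite ffunE val_prodg.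
have [] // : balanced_all p (\prod_(j < p.+1) W_pow (a j) (x j)) /\
    chi i (\prod_(j < p.+1) W_pow (a j) (x j)) = (\sum_j (i == j)%:R * x j)%R.
  apply: (big_ind2 (fun w z => balanced_all p w /\ chi i w = z)).
  - by split; [exact: balanced_all1|exact: chi1].
  - move=> u z v z' [ub <-] [vb <-]; split; first exact: balanced_allM.
    exact: chiM.
  move=> j _; split; last by rewrite chi_W_pow ?chi_gen//; exact: balanced_gen.
  apply: (sub_balanced a_rec).
  exact/closed_gen_W_pow/mem_closed_gen.
move=> _ ->; rewrite (bigD1 i)//= eqxx mul1r big1 ?addr0// => j.
by rewrite eq_sym => /negPf ->; rewrite mul0r.
Qed.

Lemma from_coords_homeomorphism : homeomorphism from_coords.
Proof.
have crc : continuous (fun q : abelianization [grp G] => coords (qrepr q)).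
  apply: quotient_cont.
  rewrite (_ : _ \o _ = coords); first exact: coords_continuous.
  by apply/funext => g /=; apply: ab_proj_eq_coords; exact: qreprK.
split.
  move=> x; apply: continuous_comp; first exact: prodg_continuous.
  exact: qproj_continuous.
exists (fun q => coords (qrepr q)); split => // [x|q].
  rewrite -[RHS]prodgK; apply: ab_proj_eq_coords; exact: qreprK.
by rewrite coordsK; exact: qreprK.
Qed.

End Abelianization.

(** * The normalizer modulo G *)

Section NormalizerQuotient.
Variables (p : nat) (a : 'I_p.+1 -> W).
Hypothesis a_rec : periodic_recursion a.
Implicit Types (i j : 'I_p.+1).
Local Notation G := (closed_gen a).
Local Notation N := (normalizer G).
Implicit Types (n m : [grp N]) (k : {ffun 'I_p.+1 -> units Z2}).

Lemma grp_conjugator n : conjugator a (subgroup_val n).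
Proof. by move=> i; apply: normalizer_lconj; exact: mem_closed_gen. Qed.

(** All multipliers of [v w] are 1, so [v w] lies in [G]; hence [w^-1] lies in [G v] and also
    conjugates [G] into itself. *)
Lemma conjugator_normalizer (w v : W) : conjugator a w -> conjugator a v ->
  (forall i, multiplier a v i * multiplier a w i = 1)%R -> carrier N w.
Proof.
move=> wM vM vw.
have Gvw : carrier G (v * w).
  apply: multiplier1_closed_gen => // [|i]; first exact: conjugatorM.
  by rewrite multiplierM.
have wV : w^-1 = (v * w)^-1 * v by rewrite invgM mulgVK.
have wVM : conjugator a w^-1.
  rewrite wV; apply: conjugatorM => //; apply: closed_gen_conjugator.
  exact: (subvg (s := G)).
apply/seteqP; split=> [_ [g Gg <-]|g Gg].
  by case: (closed_gen_lconj a_rec wM Gg).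
exists (lconj w^-1 g); last exact: lconjKV.
by case: (closed_gen_lconj a_rec wVM Gg).
Qed.

Lemma multiplier_unit n i : multiplier a (subgroup_val n) i \is a GRing.unit.
Proof.
apply/unitrPr; exists (multiplier a (subgroup_val n^-1) i).
rewrite -multiplierM//; [|exact: grp_conjugator..].
by rewrite -subgroup_valM mulgV closed_gen_multiplier//; exact: (sub1g G).
Qed.

Definition diag_action n : {ffun 'I_p.+1 -> units Z2} :=
  [ffun i => exist _ (multiplier a (subgroup_val n) i) (multiplier_unit n i)].

Lemma val_diag_action n i :
  val (diag_action n i) = multiplier a (subgroup_val n) i.
Proof. by rewrite ffunE. Qed.

Lemma diag_actionM : {morph diag_action : n m / n * m}.
Proof.
move=> n m; apply/ffunP => i; rewrite [RHS]ffunE; apply: val_inj.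
rewrite /= !val_diag_action subgroup_valM multiplierM//; exact: grp_conjugator.
Qed.

(** By multiplicativity the claim reduces to the kernel, which is [G] by
    [multiplier1_closed_gen]. *)
Lemma diag_action_eq n m : diag_action n = diag_action m <->
  qproj (in_normalizer G) n = qproj (in_normalizer G) m.
Proof.
have valM u : diag_action (n * u) = diag_action n <->
    (forall i, multiplier a (subgroup_val u) i = 1%R).
  rewrite diag_actionM; split=> [nu i|u1].
    have /(congr1 val) : diag_action n i * diag_action u i = diag_action n i.
      by rewrite -[in RHS]nu [in RHS]ffunE.
    rewrite /= -[RHS]mulr1 => /(mulrI (valP (diag_action n i))).
    by rewrite val_diag_action.
  apply/ffunP => i; rewrite ffunE; apply: val_inj => /=.
  by rewrite [X in (_ * X)%R]val_diag_action u1 mulr1.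
rewrite (_ : m = n * (n^-1 * m)); last by rewrite mulgA mulgV mul1g.
split=> [/esym/valM u1|/qprojP].
  apply/qprojP; rewrite mulKg; apply: multiplier1_closed_gen => //.
  exact: grp_conjugator.
rewrite mulKg => Gu; apply/esym/valM => i; exact: closed_gen_multiplier.
Qed.

Lemma diag_action_continuous : continuous diag_action.
Proof.
apply: ffun_continuous => i.
apply: (@continuous_comp_initial (units Z2) [grp N] Z2 val).
rewrite (_ : _ \o _ =
    chi p i \o (fun w => w * a i * w^-1) \o @subgroup_val _ N);
  last by apply/funext => n; exact: val_diag_action.
have lconj_c : continuous (fun w : W => w * a i * w^-1).
  apply: (@mulg_fun_continuous W W (fun w => w * a i));
    last exact: invg_continuous.
  apply: (@mulg_fun_continuous W W id (fun=> a i)); last exact: cst_continuous.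
  by move=> w; exact: cvg_id.
move=> n; apply: continuous_comp; first exact: subgroup_val_continuous.
by apply: continuous_comp; [exact: lconj_c|exact: chi_continuous].
Qed.

Lemma scaling_normalizer k : carrier N (scaling a (fun i => val (k i))).
Proof.
have kodd i : odd (val (k i) 0%N) by apply/Z2_unit_odd/valP.
have kVodd i : odd (val (k i)^-1 0%N) by apply/Z2_unit_odd/valP.
(* The inverse units provide an inverse of the scaling up to [G]. *)
apply: (@conjugator_normalizer _ (scaling a (fun i => val (k i)^-1))).
- exact: conjugator_scaling.
- exact: conjugator_scaling.
by move=> i; rewrite !multiplier_scaling//; apply/mulVr/valP.
Qed.

Definition scalingN k : [grp N] := subgroup_in (scaling_normalizer k).

Lemma scalingN_continuous : continuous scalingN.
Proof.
apply: continuous_subgroup.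
apply: (@ffun_W_continuous _ _ (val : units Z2 -> Z2) (scaling a)).
  exact: (@initial_continuous (units Z2) Z2 val).
by move=> n; exists n.+1 => x y; exact: agree_scaling_cong.
Qed.

Lemma diag_action_scalingN k : diag_action (scalingN k) = k.
Proof.
apply/ffunP => i; apply: val_inj; rewrite val_diag_action multiplier_scaling//.
by move=> j; apply/Z2_unit_odd/valP.
Qed.

Definition diag_iso (q : quotient (in_normalizer G)) := diag_action (qrepr q).

Lemma diag_isoE n : diag_iso (qproj (in_normalizer G) n) = diag_action n.
Proof. by apply/diag_action_eq; exact: qreprK. Qed.

Lemma diag_isoP : topgroup_iso diag_iso.
Proof.
split=> [q s|].
  rewrite -[q]qreprK -[s]qreprK -qprojM !diag_isoE.
  exact: diag_actionM.
split.
  apply: quotient_cont; rewrite (_ : _ \o _ = diag_action).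
    exact: diag_action_continuous.
  by apply/funext => n; exact: diag_isoE.
exists (fun k => qproj (in_normalizer G) (scalingN k)); split=> [k|q|k].
- apply: continuous_comp; first exact: scalingN_continuous.
  exact: qproj_continuous.
- rewrite -[q]qreprK; apply/diag_action_eq.
  by rewrite diag_isoE diag_action_scalingN.
- by rewrite diag_isoE diag_action_scalingN.
Qed.

Lemma conj_ab_from_coords n x :
  conj_ab n (from_coords a x) = from_coords a (coord_mul (diag_action n) x).
Proof.
rewrite /conj_ab ab_autE -coordsK//; congr (from_coords a).
apply/ffunP => i; rewrite ffunE [RHS]ffunE val_diag_action.
have := closed_gen_lconj a_rec (@grp_conjugator n) (subgroup_valP (prodg a x)).
move=> [_ ->]; congr (_ * _)%R.
by rewrite -[in RHS](prodgK a_rec x) ffunE.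
Qed.

End NormalizerQuotient.

Theorem theorem2p6p8 (r : nat) (hr : (1 <= r)%N) (a : 'I_r -> W)
    (ha : periodic_recursion a) :
  exists iota : {ffun 'I_r -> Z2} -> abelianization [grp closed_gen a],
    [/\ {morph iota : x y / (x + y)%R >-> x * y},
        homeomorphism iota &
        forall i : 'I_r, iota (Z2_basis i) = ab_proj (closed_gen_elt a i)] /\
    exists Phi : quotient (in_normalizer (closed_gen a)) ->
                 {ffun 'I_r -> units Z2},
      topgroup_iso Phi /\
      forall (n : [grp normalizer (closed_gen a)]) (x : {ffun 'I_r -> Z2}),
        conj_ab n (iota x) =
        iota (coord_mul (Phi (qproj (in_normalizer (closed_gen a)) n)) x).
Proof.
case: r hr a ha => // p _ a ha; exists (from_coords a); split.
  split; first exact: from_coordsD.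
    exact: from_coords_homeomorphism.
  exact: from_coords_basis.
exists (diag_iso ha); split; first exact: diag_isoP.
by move=> n x; rewrite diag_isoE; exact: conj_ab_from_coords.
Qed.
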